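(* Let $\beta>0$, let $\nu$ be a probability measure on $\mathbb{R}$ with finite second moment, $\int_{\mathbb{R}} x^2\,d\nu(x)<\infty$, and let $\mathbf{h}=(h_i)_{i\in\mathbb{N}}$ be i.i.d. random variables with marginal law $\nu$ and joint law $\mu=\nu^{\otimes\mathbb{N}}$. Suppose that $\nu$ is pure and centered at $m$, i.e. $G$ has a unique global minimum, located at $m\in\mathbb{R}$, and let $k\in\mathbb{N}$, $k\ge1$, be the type and $\lambda>0$ the strength of $m$. Then, for $\mu$-almost every realization of $\mathbf{h}$, for every $\alpha$ with $1-\frac{1}{2(2k-1)}<\alpha<1$ the sequence of measures $$\left(P_{n,\beta}^{\mathbf{h}}\left(\frac{S_n-nm}{n^{\alpha}}\in\bullet\right)\right)_{n\in\mathbb{N}}$$ on $\mathbb{R}$ satisfies a moderate deviations principle with speed $n^{1-2k(1-\alpha)}$ and rate function $$I(x)=\begin{cases}\dfrac{x^2}{2\sigma^2}, & \text{if } k=1,\\[2mm] \dfrac{\lambda x^{2k}}{(2k)!}, & \text{if } k\ge 2,\end{cases}\qquad \text{where } \sigma^2=\lambda^{-1}-\beta^{-1}.$$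
   Context: Random field Curie-Weiss model: for a realization $\mathbf{h}=(h_i)_{i\in\mathbb{N}}$ of the random field and $n\in\mathbb{N}$, $P_{n,\beta}^{\mathbf{h}}$ is the probability measure on $\{-1,+1\}^n$ given by $$P_{n,\beta}^{\mathbf{h}}(\sigma)=\frac{1}{Z_{n,\beta}^{\mathbf{h}}}\exp\Big(\frac{\beta}{2n}\Big[\sum_{i=1}^n\sigma_i\Big]^2+\beta\sum_{i=1}^n h_i\sigma_i\Big),$$ where $Z_{n,\beta}^{\mathbf{h}}$ is the normalizing constant, and $S_n=\sum_{i=1}^n\sigma_i$. The function $G$: $G(x)=\frac{\beta}{2}x^2-\int_{\mathbb{R}}\ln\cosh[\beta(x+y)]\,d\nu(y)$ for $x\in\mathbb{R}$. A (local or global) minimum $m$ of $G$ is of type $k\in\mathbb{N}$ ($k\ge1$) and strength $\lambda>0$ if $G(x)=G(m)+\frac{\lambda}{(2k)!}(x-m)^{2k}+\mathcal{O}((x-m)^{2k+1})$ as $x\to m$. Moderate deviations principle (technically the same as a large deviations principle): a sequence of measures $(\mu_n)_n$ on $\mathbb{R}$ satisfies it with speed $(a_n)_n$ and (good) rate function $I$ if $I$ is lower semicontinuous with compact level sets and for all Borel sets $C\subseteq\mathbb{R}$ $$-\inf_{x\in C^\circ}I(x)\le\liminf_{n\to\infty}\frac{1}{a_n}\ln\mu_n(C)\le\limsup_{n\to\infty}\frac{1}{a_n}\ln\mu_n(C)\le-\inf_{x\in\overline{C}}I(x).$$ *)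

(* Defs.v *)
From HB Require Import structures.
From mathcomp Require Import all_boot all_order all_algebra finmap.
From mathcomp Require Import all_classical all_reals all_analysis measurable_realfun.

Set Implicit Arguments.
Unset Strict Implicit.
Unset Printing Implicit Defensive.

Import Order.TTheory GRing.Theory Num.Theory.
Import numFieldNormedType.Exports.

Local Open Scope classical_set_scope.
Local Open Scope ring_scope.

Definition mutually_independent d (T : measurableType d) (R : realType)
    (P : probability T R) (X : nat -> {RV P >-> R}) : Prop :=
  forall (J : {fset nat}) (B : nat -> set R),
    (forall i, i \in J -> measurable (B i)) ->
    P (\bigcap_(i in [set` J]) (X i @^-1` B i)) =
    (\prod_(i <- J) P (X i @^-1` B i))%E.

(* The laws are compared on Borel sets only: the value of a measure of the
   library on a non-measurable set is unconstrained. *)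
Definition iid_with_law d (T : measurableType d) (R : realType)
    (P : probability T R) (nu : probability R R)
    (X : nat -> {RV P >-> R}) : Prop :=
  mutually_independent X /\
  forall i (B : set R), measurable B -> distribution P (X i) B = nu B.

Section spins.
Context {R : realType}.

(* A configuration in {-1,+1}^n is a tuple of n booleans, [true] standing for
   +1 and [false] for -1. *)
Definition spin (b : bool) : R := if b then 1 else -1.

Definition total_spin n (s : n.-tuple bool) : R := \sum_(i < n) spin (tnth s i).

Definition gibbs_weight (beta : R) (h : nat -> R) n (s : n.-tuple bool) : R :=
  expR (beta / (2 * n%:R) * total_spin s ^+ 2
        + beta * \sum_(i < n) h i * spin (tnth s i)).

Definition partition_function (beta : R) (h : nat -> R) n : R :=
  \sum_(s : n.-tuple bool) gibbs_weight beta h s.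

Definition gibbs_pmf (beta : R) (h : nat -> R) n (s : n.-tuple bool) : R :=
  gibbs_weight beta h s / partition_function beta h n.

Definition gibbs (beta : R) (h : nat -> R) n : set (n.-tuple bool) -> \bar R :=
  fun A => (\sum_(s \in A) (gibbs_pmf beta h s)%:E)%E.

Definition rescaled_spin (m alpha : R) n (s : n.-tuple bool) : R :=
  (total_spin s - n%:R * m) / n%:R `^ alpha.

End spins.

Arguments gibbs {R} beta h n A.
Arguments rescaled_spin {R} m alpha n s.

Section gibbs_probability.
Context {R : realType} (beta : R) (h : nat -> R) (n : nat).

Lemma partition_function_gt0 : 0 < partition_function beta h n.
Proof.
rewrite /partition_function (bigD1 [tuple of nseq n true])//=.
rewrite ltr_pwDl ?expR_gt0//.
by apply: sumr_ge0 => s _; exact: expR_ge0.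
Qed.

Lemma gibbs_pmf_ge0 (s : n.-tuple bool) : 0 <= gibbs_pmf beta h s.
Proof. by rewrite divr_ge0 ?expR_ge0// ltW// partition_function_gt0. Qed.

Local Notation P := (gibbs beta h n).

Let gibbs0 : P set0 = 0%E.
Proof. by rewrite /gibbs fsbig_set0. Qed.

Let gibbs_ge0 A : (0 <= P A)%E.
Proof.
rewrite /gibbs fsbig_finite//= sumEFin lee_fin.
by apply: sumr_ge0 => /= s _; exact: gibbs_pmf_ge0.
Qed.

Let gibbs_sigma_additive : semi_sigma_additive P.
Proof.
move=> F mF tF mUF; rewrite /gibbs; apply: cvg_toP.
  apply: ereal_nondecreasing_is_cvgn => i j ij.
  by apply: lee_sum_nneg_natr => // k _ _; exact: gibbs_ge0.
transitivity (\sum_(0 <= i <oo) (\esum_(s in F i) (gibbs_pmf beta h s)%:E))%E.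
  apply: eq_eseriesr => k _; rewrite esum_fset//= => s _.
  by rewrite lee_fin gibbs_pmf_ge0.
rewrite -nneseries_sum_bigcup//=; last first.
  by move=> s; rewrite lee_fin gibbs_pmf_ge0.
by rewrite esum_fset//= => s _; rewrite lee_fin gibbs_pmf_ge0.
Qed.

HB.instance Definition _ := isMeasure.Build _ _ _ P
  gibbs0 gibbs_ge0 gibbs_sigma_additive.

Let gibbs_setT : P setT = 1%E.
Proof.
rewrite /gibbs.
have -> : [set: n.-tuple bool] = [set` xpredT] by apply/seteqP; split.
rewrite -(bigfs _ (r := index_enum _))/=.
- rewrite sumEFin -mulr_suml divff// gt_eqF//.
  exact: partition_function_gt0.
- exact: index_enum_uniq.
- by move=> s _; rewrite mem_index_enum.
Qed.

HB.instance Definition _ :=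
  @Measure_isProbability.Build _ _ R P gibbs_setT.

End gibbs_probability.

Section rescaled_spin_measurable.
Context {R : realType} (m alpha : R) (n : nat).

Let measurable_rescaled_spin :
  measurable_fun [set: n.-tuple bool] (rescaled_spin m alpha n).
Proof.
apply: measurable_funM => //; apply: measurable_funB => //.
apply: measurable_sum => i.
apply: (measurableT_comp (f := @spin R)) => //.
exact: measurable_tnth.
Qed.

HB.instance Definition _ := isMeasurableFun.Build _ _ _ _
  (rescaled_spin m alpha n) measurable_rescaled_spin.

End rescaled_spin_measurable.

Section free_energy.
Context {R : realType}.

Definition cosh (x : R) : R := (expR x + expR (- x)) / 2.

Definition G_fun (beta : R) (nu : probability R R) (x : R)
    : R :=
  beta / 2 * x ^+ 2 - \int[nu]_y ln (cosh (beta * (x + y))).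

Definition unique_global_min (f : R -> R) (m : R) : Prop :=
  forall x, x != m -> f m < f x.

Definition type_strength (f : R -> R) (m : R) (k : nat) (lambda : R) : Prop :=
  [/\ (1 <= k)%N, 0 < lambda &
    f = (fun x => f m + lambda / ((2 * k)`!)%:R * (x - m) ^+ (2 * k))
        +O_ m (fun x => (x - m) ^+ (2 * k).+1)].

Definition pure_centered (beta : R) (nu : probability R R)
    (m : R) : Prop :=
  unique_global_min (G_fun beta nu) m.

End free_energy.

Section deviations.
Context {R : realType}.
Local Open Scope ereal_scope.

Definition good_rate_function (I : R -> \bar R) : Prop :=
  lower_semicontinuous I /\ forall c : R, compact [set x | I x <= c%:E].

Definition moderate_deviations_principle
    (mu : nat -> {measure set R -> \bar R})
    (a : nat -> R) (I : R -> \bar R) : Prop :=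
  good_rate_function I /\
  forall C : set R, measurable C ->
    - ereal_inf (I @` C°)
      <= limn_einf (fun n => (a n)^-1%:E * lne (mu n C)) /\
    limn_esup (fun n => (a n)^-1%:E * lne (mu n C))
      <= - ereal_inf (I @` closure C).

End deviations.

Definition rate {R : realType} (beta lambda : R) (k : nat) (x : R) : R :=
  let sigma2 := lambda^-1 - beta^-1 in
  if k == 1%N then x ^+ 2 / (2 * sigma2)
  else lambda * x ^+ (2 * k) / ((2 * k)`!)%:R.

(* Main.v *)
(** Write G_n for the empirical version of G, Z0 = 2^n exp (- n G_n(m)), u for
    the magnetization S_n / n, and q_x for the law of independent spins in the
    fields x + h_i. Completing the square, the Gibbs weight of s equals, for
    every x,
      2^n exp (- n G_n(x)) exp (n beta (u(s) - x)^2 / 2) q_x(s).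
    With x = m this bounds the partition function below by Z0. Since u takes
    only n + 1 values, choosing x as a function of u(s) bounds the weight of any
    event above; choosing x so that q_x concentrates at the wanted magnetization
    bounds windows below. For k >= 2 the choice is x = u; for k = 1 it is
    x - m = beta / (beta - lambda) (u - m), which turns the coefficient lambda
    into 1 / sigma^2. Both bounds only need that G_n(m + t) - G_n(m) is close to
    G(m + t) - G(m): the increments of ln cosh are bounded by beta |t|, so by
    Hoeffding's inequality on a grid of mesh 1/n and the Borel-Cantelli lemma the
    error is almost surely O(|t| sqrt (ln n / n) + 1/n) uniformly in bounded t,
    which is negligible exactly in the stated range of alpha. *)

Require Import Defs.
From mathcomp Require Import all_boot all_order all_algebra.
From mathcomp Require Import all_classical all_reals all_analysis.
From mathcomp Require Import finmap measurable_realfun ring lra.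

Set Implicit Arguments.
Unset Strict Implicit.
Unset Printing Implicit Defensive.

Import Order.TTheory GRing.Theory Num.Theory.
Import numFieldNormedType.Exports.

Local Open Scope classical_set_scope.
Local Open Scope ring_scope.

(** * Products of functions of independent variables *)

Section independence.
Context {R : realType} d (Omega : measurableType d) (P : probability Omega R).
Variable nu : probability R R.
Import HBNNSimple.

(* By monotone convergence, factorization against indicators of X-measurable
   events extends to all nonnegative measurable functions of X. *)
Lemma integral_mul_factor (X : Omega -> R) (W : Omega -> R) (c : R)
    (g : R -> R) :
  measurable_fun setT X -> measurable_fun setT W -> (forall w, 0 <= W w) ->
  (forall B, measurable B ->
    (\int[P]_w (W w * \1_B (X w))%:E = c%:E * nu B)%E) ->
  measurable_fun setT g -> (forall x, 0 <= g x) ->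
  (\int[P]_w (W w * g (X w))%:E = c%:E * \int[nu]_x (g x)%:E)%E.
Proof.
move=> mX mW W0 WB mg g0.
have mEg : measurable_fun setT (EFin \o g) by exact/measurable_EFinP.
pose h := nnsfun_approx measurableT mEg.
have hg x : ((h n x)%:E @[n --> \oo] --> (g x)%:E)%E.
  by apply: (cvg_nnsfun_approx measurableT mEg) => // y _; rewrite lee_fin.
have ndh x : {homo (fun n => h n x) : m n / (m <= n)%N >-> m <= n}.
  by move=> m n mn; exact/lefP/nd_nnsfun_approx.
have simple n : (\int[P]_w (W w * h n (X w))%:E
    = c%:E * \int[nu]_x (h n x)%:E)%E.
  rewrite integralT_nnsfun sintegralE.
  under eq_integral => w _.
    rewrite fimfunE EFinM -fsumEFin// ge0_mule_fsumr; last first.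
      by move=> y; rewrite EFinM; exact: nnfun_muleindic_ge0.
    over.
  rewrite /= ge0_integral_fsum//; last 2 first.
  - move=> y; apply/measurable_EFinP; apply: measurable_funM => //.
    apply: measurable_funM => //.
    by apply: (measurableT_comp _ mX); exact: measurable_indic.
  - move=> y w _; rewrite mule_ge0 ?lee_fin//.
    exact: nnfun_muleindic_ge0.
  rewrite ge0_mule_fsumr; last by move=> y; exact: nnsfun_mulemu_ge0.
  apply: eq_fsbigr => y /set_mem[x _ hxy].
  have y0 : 0 <= y by rewrite -hxy.
  rewrite muleCA -WB// -ge0_integralZl//.
  - by apply: eq_integral => w _; rewrite -!EFinM mulrCA.
  - apply/measurable_EFinP; apply: measurable_funM => //.
    by apply: (measurableT_comp _ mX); exact: measurable_indic.
  - by move=> w _; rewrite lee_fin mulr_ge0.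
have cvgl : (\int[nu]_x (h n x)%:E @[n --> \oo] --> \int[nu]_x (g x)%:E)%E.
  have -> : (\int[nu]_x (g x)%:E = \int[nu]_x limn (fun n => (h n x)%:E))%E.
    by apply: eq_integral => x _; apply/esym/cvg_lim => //; exact: hg.
  apply: cvg_monotone_convergence => //.
  - by move=> n; apply/measurable_EFinP.
  - by move=> n x _; rewrite lee_fin.
  - by move=> x _ i j ij; rewrite lee_fin ndh.
have cvgr : (\int[P]_w (W w * h n (X w))%:E @[n --> \oo]
    --> \int[P]_w (W w * g (X w))%:E)%E.
  have -> : (\int[P]_w (W w * g (X w))%:E
      = \int[P]_w limn (fun n => (W w * h n (X w))%:E))%E.
    apply: eq_integral => w _; apply/esym/cvg_lim => //.
    under eq_fun do rewrite EFinM.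
    by rewrite EFinM; apply: cvgeZl => //; exact: hg.
  apply: cvg_monotone_convergence => //.
  - move=> n; apply/measurable_EFinP; apply: measurable_funM => //.
    exact: measurableT_comp.
  - by move=> n w _; rewrite lee_fin mulr_ge0.
  - by move=> w _ i j ij; rewrite lee_fin ler_wpM2l// ndh.
apply: (cvg_unique _ cvgr); first exact: ereal_hausdorff.
rewrite (funext simple).
exact: cvgeZl.
Qed.

Variable X : nat -> {RV P >-> R}.
Hypothesis iidX : iid_with_law nu X.

Let law_fin B : measurable B -> (nu B = (fine (nu B))%:E)%E.
Proof. by move=> mB; rewrite fineK// fin_num_measure. Qed.

(** The product of the indicators is the indicator of a finite intersection of preimages, to which
    independence applies directly. *)
Lemma iid_prod_indic n (B : nat -> set R) : (forall i, measurable (B i)) ->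
  (\int[P]_w (\prod_(0 <= i < n) \1_(B i) (X i w))%:E
   = (\prod_(0 <= i < n) fine (nu (B i)))%:E)%E.
Proof.
move=> mB; have [indX lawX] := iidX.
pose J := [fset i | i in index_iota 0 n]%fset.
have JE : perm_eq J (index_iota 0 n).
  apply: uniq_perm; [exact: fset_uniq|exact: iota_uniq|].
  by move=> i; rewrite in_fset_/=.
pose A := \bigcap_(i in [set` J]) (X i @^-1` B i).
have mA : measurable A.
  apply: fin_bigcap_measurable; first exact: finite_fset.
  move=> i _; rewrite -[X in measurable X]setTI.
  exact: measurable_funP.
transitivity (\int[P]_w (\1_A w)%:E)%E.
  apply: eq_integral => w _; congr EFin.
  have [Aw|nAw] := pselect (A w).
    rewrite indicE mem_set// big_seq big1// => i iJ.
    rewrite indicE mem_set//; apply: Aw => /=.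
    by rewrite (perm_mem JE).
  rewrite indicE memNset//.
  have [i [iJ nBi]] : exists i, i \in J /\ ~ B i (X i w).
    apply: contrapT => h; apply: nAw => i /= iJ.
    by apply: contrapT => nBi; apply: h; exists i.
  rewrite -(perm_big _ JE) (big_rem i)//=.
  by rewrite indicE memNset// mul0r.
rewrite integral_indic// setIT.
apply: (etrans (indX J B (fun i _ => mB i))).
rewrite (perm_big _ JE)/= -prodEFin; apply: eq_bigr => i _.
by rewrite -law_fin//; exact: lawX.
Qed.

(** Interpolation between indicators only ([j = 0]) and no indicators ([j = n]): each step of the
    induction on [j] turns one indicator into [g j] by [integral_mul_factor]. *)
Lemma iid_prod_mixed n j (g : nat -> R -> R) (B : nat -> set R) :
  (forall i, measurable_fun setT (g i)) -> (forall i x, 0 <= g i x) ->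
  (forall i, \int[nu]_x (g i x)%:E < +oo)%E ->
  (forall i, measurable (B i)) -> (j <= n)%N ->
  (\int[P]_w (\prod_(0 <= i < j) g i (X i w) *
              \prod_(j <= i < n) \1_(B i) (X i w))%:E
   = (\prod_(0 <= i < j) fine (\int[nu]_x (g i x)%:E) *
      \prod_(j <= i < n) fine (nu (B i)))%:E)%E.
Proof.
move=> mg g0 gfin; elim: j B => [|j ih] B mB jn.
  under eq_integral do rewrite big_geq// mul1r.
  by rewrite big_geq// mul1r iid_prod_indic.
pose W w := \prod_(0 <= i < j) g i (X i w) *
  \prod_(j.+1 <= i < n) \1_(B i) (X i w).
pose c := \prod_(0 <= i < j) fine (\int[nu]_x (g i x)%:E)%E *
  \prod_(j.+1 <= i < n) fine (nu (B i)).
have -> : \prod_(0 <= i < j.+1) fine (\int[nu]_x (g i x)%:E)%E *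
      \prod_(j.+1 <= i < n) fine (nu (B i))
    = c * fine (\int[nu]_x (g j x)%:E)%E.
  by rewrite big_nat_recr//= mulrAC.
rewrite [RHS]EFinM fineK; last first.
  by rewrite ge0_fin_numE// integral_ge0// => x _; rewrite lee_fin.
rewrite -(@integral_mul_factor (X j) W c (g j))//.
- by apply: eq_integral => w _; rewrite big_nat_recr//= mulrAC.
- apply: measurable_funM; apply: measurable_prod => i _.
    by apply: (measurableT_comp (mg i)).
  by apply: (measurableT_comp (f := (\1_(B i) : R -> R))).
- by move=> w; rewrite mulr_ge0// prodr_ge0.
- move=> C mC.
  (* Putting [C] in place of the [j]-th set turns the induction hypothesis into the required
     factorization against [\1_C] of [X j]. *)
  pose B' i := if i == j then C else B i.
  have B'E i : (j < i)%N -> B' i = B i by rewrite /B'; case: ltngtP.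
  have B'j : B' j = C by rewrite /B' eqxx.
  have mB' i : measurable (B' i) by rewrite /B'; case: ifP.
  have := ih B' mB' (ltnW jn).
  have E (H : nat -> set R -> R) : \prod_(j.+1 <= i < n) H i (B' i) =
      \prod_(j.+1 <= i < n) H i (B i).
    by apply: eq_big_nat => i /andP[ji _]; rewrite B'E.
  rewrite (big_ltn jn) B'j.
  have /= -> := E (fun i B => fine (nu B)).
  rewrite mulrCA mulrC EFinM fineK ?fin_num_measure// => <-.
  apply: eq_integral => w _; rewrite (big_ltn jn) B'j.
  have /= -> := E (fun i B => \1_B (X i w)).
  by rewrite /W -mulrA [_ * \1_C _]mulrC.
Qed.

Lemma iid_prod n (g : R -> R) :
  measurable_fun setT g -> (forall x, 0 <= g x) ->
  (\int[nu]_x (g x)%:E < +oo)%E ->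
  (\int[P]_w (\prod_(i < n) g (X i w))%:E
   = (fine (\int[nu]_x (g x)%:E) ^+ n)%:E)%E.
Proof.
move=> mg g0 gfin.
have := @iid_prod_mixed n n (fun=> g) (fun=> setT).
rewrite prodr_const_nat subn0 [X in _ * X]big_geq// mulr1 => <-//.
by apply: eq_integral => w _; rewrite [X in _ * X]big_geq// mulr1 big_mkord.
Qed.

End independence.

(** * Hoeffding's inequality *)

(** For a centered variable the linear term integrates to zero, which leaves a sub-Gaussian bound.
    For [|x| < 1/2] the intermediate quantity is [1 / (1 - x)]. *)
Lemma expR_le_quadratic {R : realType} (x : R) : expR x <= x + expR (2 * x ^+ 2).
Proof.
have [x_ge|x_lt] := leP (1 / 2) x.
  by rewrite (@le_trans _ _ (expR (2 * x ^+ 2)))// ?ler_expR; nra.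
have e2 := expR_ge1Dx (2 * x ^+ 2).
have [x_le|x_gt] := leP x (- (1 / 2)).
  have : expR x <= 1 by rewrite -expR0 ler_expR; lra.
  by nra.
have ex : expR x <= (1 - x)^-1.
  rewrite -[x in expR x]opprK expRN lef_pV2 ?posrE ?expR_gt0//; last by lra.
  exact: expR_ge1Dx.
suff : (1 - x)^-1 <= 1 + x + 2 * x ^+ 2 by lra.
rewrite -[leLHS]mul1r ler_pdivrMr; last by lra.
by nra.
Qed.

Section hoeffding.
Context {R : realType} d (Omega : measurableType d) (P : probability Omega R).
Variables (nu : probability R R) (X : nat -> {RV P >-> R}).
Hypothesis iidX : iid_with_law nu X.
Variables (phi : R -> R) (M : R).
Hypotheses (mphi : measurable_fun setT phi) (phiM : forall x, `|phi x| <= M).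

Let c := \int[nu]_x phi x.

Lemma bounded_integrable : nu.-integrable setT (EFin \o phi).
Proof.
apply: (le_integrable measurableT _ _
  (finite_measure_integrable_cst nu M measurableT)).
  exact/measurable_EFinP.
by move=> x _ /=; rewrite lee_fin (le_trans (phiM x))// ler_norm.
Qed.

Let c_le : `|c| <= M.
Proof.
apply: (le_trans (le_normr_Rintegral measurableT bounded_integrable)).
have -> : M = \int[nu]_x M.
  rewrite Rintegral_cst// [X in fine X](_ : _ = 1%E) ?mulr1//.
  exact: probability_setT.
apply: le_Rintegral => //.
- exact: (integrable_norm bounded_integrable).
- exact: finite_measure_integrable_cst.
Qed.

Let mg s : measurable_fun setT (fun x => expR (s * (phi x - c))).
Proof.
apply: measurableT_comp => //; apply: measurable_funM => //.
exact: measurable_funB.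
Qed.

(** [expR_le_quadratic] at [s * (phi x - c)], where [|phi x - c| <= 2 M]; hence the constant
    [8 = 2 * 2^2]. *)
Lemma mgf_centered_le s :
  (\int[nu]_x (expR (s * (phi x - c)))%:E <= (expR (8 * s ^+ 2 * M ^+ 2))%:E)%E.
Proof.
have -> : (expR (8 * s ^+ 2 * M ^+ 2))%:E =
    (\int[nu]_x (s * (phi x - c) + expR (8 * s ^+ 2 * M ^+ 2))%:E)%E.
  have iphi : nu.-integrable setT (fun x => (phi x - c)%:E).
    apply: (eq_integrable measurableT ((EFin \o phi) \- cst c%:E)%E) => //.
    apply: (integrableB measurableT bounded_integrable).
    exact: finite_measure_integrable_cst.
  under eq_integral do rewrite EFinD EFinM.
  rewrite integralD//; last 2 first.
  - exact: (integrableZl measurableT).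
  - exact: finite_measure_integrable_cst.
  rewrite integralZl//.
  have -> : (\int[nu]_x (phi x - c)%:E = 0)%E.
    rewrite (integralB_EFin measurableT bounded_integrable); last first.
      exact: finite_measure_integrable_cst.
    rewrite integral_cst//= [X in (_ * X)%E](_ : _ = 1%E); last first.
      exact: probability_setT.
    rewrite mule1 /c /Rintegral fineK ?subee//.
    - exact: (integrable_fin_num measurableT bounded_integrable).
    - exact: (integrable_fin_num measurableT bounded_integrable).
  rewrite mule0 add0e integral_cst//= [X in (_ * X)%E](_ : _ = 1%E) ?mule1//.
  exact: probability_setT.
apply: ge0_le_integral => //.
- exact/measurable_EFinP.
- apply/measurable_EFinP; apply: measurable_funD => //.
  by apply: measurable_funM => //; exact: measurable_funB.
move=> x _; rewrite lee_fin (le_trans (expR_le_quadratic _))// lerD2l ler_expR.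
have : `|phi x - c| <= 2 * M.
  by rewrite (le_trans (ler_normB _ _))//; have := phiM x; have := c_le; lra.
rewrite exprMn -[(phi x - c) ^+ 2]real_normK ?num_real//.
have := sqr_ge0 s; have := normr_ge0 (phi x - c).
set a := `| _ - _ |; set b := s ^+ 2 => a0 b0 a2.
have : a ^+ 2 <= 4 * M ^+ 2 by nra.
nra.
Qed.

(** Chernoff's bound: the indicator of the event is at most the exponential of [s] times the excess
    of the sum over [t], whose expectation factorizes by independence. The parameter [s] is fixed
    only in [bad_le]. *)
Lemma hoeffding_upper (n : nat) (s t : R) : 0 <= s ->
  (P [set w | (t <= \sum_(i < n) (phi (X i w) - c))%R]
   <= (expR (8 * n%:R * s ^+ 2 * M ^+ 2 - s * t))%:E)%E.
Proof.
move=> s0; set A := [set w | _].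
have mS : measurable_fun setT (fun w => \sum_(i < n) (phi (X i w) - c)).
  apply: measurable_sum => i; apply: measurable_funB => //.
  exact: measurableT_comp.
have mA : measurable A.
  have -> : A = (fun w => \sum_(i < n) (phi (X i w) - c)) @^-1` `[t, +oo[.
    by apply/seteqP; split => w /=; rewrite in_itv/= andbT.
  by rewrite -[X in measurable X]setTI; exact: mS.
pose K := fine (\int[nu]_x (expR (s * (phi x - c)))%:E)%E.
have K_ge0 : 0 <= K.
  by rewrite fine_ge0// integral_ge0// => x _; rewrite lee_fin expR_ge0.
have intE := iid_prod iidX n (mg s) (fun=> expR_ge0 _)
  (le_lt_trans (mgf_centered_le s) (ltry _)).
have K_le : K <= expR (8 * s ^+ 2 * M ^+ 2).
  rewrite -lee_fin fineK ?mgf_centered_le//.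
  rewrite ge0_fin_numE ?(le_lt_trans (mgf_centered_le s)) ?ltry//.
  by apply: integral_ge0 => x _; rewrite lee_fin expR_ge0.
rewrite expRD.
apply: (@le_trans _ _ (\int[P]_w (expR (- (s * t)) *
    \prod_(i < n) expR (s * (phi (X i w) - c)))%:E)%E).
  rewrite -(setIT A) -integral_indic//; apply: ge0_le_integral => //.
  - exact/measurable_EFinP/measurable_indic.
  - apply/measurable_EFinP; apply: measurable_funM => //.
    by apply: measurable_prod => i _; exact: (measurableT_comp (mg s)).
  - move=> w _; rewrite lee_fin -expR_sum -mulr_sumr -expRD indicE.
    have [Aw|_] := boolP (w \in A); last by rewrite expR_ge0.
    rewrite -expR0 ler_expR addrC subr_ge0 ler_wpM2l//.
    exact: (set_mem Aw).
under eq_integral do rewrite EFinM.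
rewrite ge0_integralZl//; last 2 first.
- apply/measurable_EFinP.
  by apply: measurable_prod => i _; exact: (measurableT_comp (mg s)).
- by move=> w _; rewrite lee_fin prodr_ge0// => i _; exact: expR_ge0.
rewrite intE -EFinM lee_fin mulrC ler_wpM2r ?expR_ge0//.
have -> : 8 * n%:R * s ^+ 2 * M ^+ 2 = 8 * s ^+ 2 * M ^+ 2 * n%:R by ring.
by rewrite expRM_natr lerXn2r ?nnegrE ?expR_ge0.
Qed.
End hoeffding.

Lemma hoeffding {R : realType} d (Omega : measurableType d)
    (P : probability Omega R) (nu : probability R R) (X : nat -> {RV P >-> R})
    (phi : R -> R) (M : R) (n : nat) (s t : R) :
  iid_with_law nu X -> measurable_fun setT phi -> (forall x, `|phi x| <= M) ->
  0 <= s ->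
  (P [set w | (t < `|\sum_(i < n) phi (X i w) - n%:R * \int[nu]_x phi x|)%R]
   <= (2 * expR (8 * n%:R * s ^+ 2 * M ^+ 2 - s * t))%:E)%E.
Proof.
move=> iidX mphi phiM s0.
have mN : measurable_fun setT (\- phi) by exact: measurable_funN.
have NM x : `|(\- phi) x| <= M by rewrite /= normrN.
have intN : \int[nu]_x (- phi x) = - \int[nu]_x phi x.
  rewrite -mulN1r -RintegralZl//; last exact: (bounded_integrable nu mphi phiM).
  by apply: eq_Rintegral => x _; rewrite mulN1r.
have mS (psi : R -> R) : measurable_fun setT psi -> measurable
    [set w | t <= \sum_(i < n) (psi (X i w) - \int[nu]_x psi x)].
  move=> mpsi.
  have -> : [set w | t <= \sum_(i < n) (psi (X i w) - \int[nu]_x psi x)]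
    = (fun w => \sum_(i < n) (psi (X i w) - \int[nu]_x psi x)) @^-1` `[t, +oo[.
    by apply/seteqP; split => w /=; rewrite in_itv/= andbT.
  rewrite -[X in measurable X]setTI.
  apply: measurable_sum => // i; apply: measurable_funB => //.
  exact: measurableT_comp.
have cE (psi : R -> R) w : \sum_(i < n) (psi (X i w) - \int[nu]_x psi x) =
    \sum_(i < n) psi (X i w) - n%:R * \int[nu]_x psi x.
  by rewrite big_split/= sumrN sumr_const card_ord mulr_natl.
apply: (@le_trans _ _ (P
   ([set w | t <= \sum_(i < n) (phi (X i w) - \int[nu]_x phi x)] `|`
    [set w | t <= \sum_(i < n) ((\- phi) (X i w) - \int[nu]_x (\- phi) x)]))).
  apply: le_measure; [apply/mem_set|apply/mem_set|].
  - have -> : [set w | t < `|\sum_(i < n) phi (X i w) - n%:R * \int[nu]_x phi x|]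
      = (fun w => `|\sum_(i < n) phi (X i w) - n%:R * \int[nu]_x phi x|)
          @^-1` `]t, +oo[.
      by apply/seteqP; split => w /=; rewrite in_itv/= andbT.
    rewrite -[X in measurable X]setTI.
    apply: measurableT_comp => //; apply: measurable_funB => //.
    by apply: measurable_sum => i; exact: measurableT_comp.
  - by apply: measurableU; exact: mS.
  move=> w /=; rewrite !cE /= intN sumrN mulrN -opprD.
  set y := _ - _; have [y0|y0] := leP 0 y.
    by rewrite ger0_norm// => /ltW; left.
  by rewrite ltr0_norm// => /ltW; right.
apply: (le_trans (measureU2 _ _ _)); [exact: mS|exact: mS|].
rewrite mulr2n mulrDl mul1r EFinD.
by apply: leeD; exact: (hoeffding_upper iidX).
Qed.

(** * The function ln cosh *)

Section lncosh.
Context {R : realType}.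
Implicit Types x y a b : R.

Definition lncosh x : R := ln (cosh x).

Lemma cosh_gt0 x : 0 < cosh x.
Proof. by rewrite /cosh divr_gt0// addr_gt0// expR_gt0. Qed.

Lemma cosh0 : cosh (0 : R) = 1.
Proof. by rewrite /cosh oppr0 expR0; lra. Qed.

Lemma cosh_shift a b : cosh (a + b) <= expR `|b| * cosh a.
Proof.
rewrite /cosh opprD !expRD mulrA ler_pM2r// mulrDr.
have hb : expR b <= expR `|b| by rewrite ler_expR ler_norm.
have hNb : expR (- b) <= expR `|b| by rewrite ler_expR -normrN ler_norm.
by rewrite lerD// mulrC ler_wpM2r// expR_ge0.
Qed.

Lemma lncosh_lipschitz a b : `|lncosh a - lncosh b| <= `|a - b|.
Proof.
have half u v : lncosh u - lncosh v <= `|u - v|.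
  have -> : `|u - v| = ln (expR `|u - v|) by rewrite expRK.
  rewrite lerBlDr -lnM ?posrE ?expR_gt0 ?cosh_gt0//.
  rewrite ler_ln ?posrE ?cosh_gt0 //; last by rewrite mulr_gt0 ?expR_gt0 ?cosh_gt0.
  by rewrite -[u in leLHS](subrKC v) cosh_shift.
by rewrite ler_norml half andbT lerNl opprB distrC half.
Qed.

Lemma abs_lncosh_le x : `|lncosh x| <= `|x|.
Proof. by have := lncosh_lipschitz x 0; rewrite /lncosh cosh0 ln1 !subr0. Qed.

Lemma measurable_lncosh (D : set R) : measurable_fun D (@lncosh).
Proof.
apply: (@measurable_funS _ _ _ _ setT) => //.
apply: (measurableT_comp (f := @ln R)) => //.
apply: measurable_funM => //; apply: measurable_funD => //.
by apply: (measurableT_comp (f := @expR R)) => //; exact: oppr_measurable.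
Qed.

(* cosh (a+b) cosh (a-b) = cosh^2 a + sinh^2 b, and sinh^2 b >= b^2 / 4. *)
Lemma lncosh_second_difference a b :
  ln (1 + b ^+ 2 / 4 / cosh a ^+ 2) <=
  lncosh (a + b) + lncosh (a - b) - 2 * lncosh a.
Proof.
have ca := cosh_gt0 a.
have -> : 2 * lncosh a = ln (cosh a ^+ 2) by rewrite lnXn// mulr_natl.
have ca2 : 0 < cosh a ^+ 2 by rewrite exprn_gt0.
have cab : 0 < cosh (a + b) * cosh (a - b) by rewrite mulr_gt0// cosh_gt0.
have q0 : 0 <= b ^+ 2 / 4 / cosh a ^+ 2.
  by rewrite divr_ge0 ?(ltW ca2)// divr_ge0 ?sqr_ge0.
rewrite /lncosh -lnM ?posrE ?cosh_gt0// -ln_div ?posrE//.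
rewrite ler_ln ?posrE ?divr_gt0//; last by lra.
rewrite ler_pdivlMr// mulrDl mul1r divfK ?gt_eqF//.
pose sh := (expR b - expR (- b)) / 2.
have -> : cosh (a + b) * cosh (a - b) = cosh a ^+ 2 + sh ^+ 2.
  have ea : expR a * expR (- a) = 1 by rewrite -expRD subrr expR0.
  have eb : expR b * expR (- b) = 1 by rewrite -expRD subrr expR0.
  rewrite /cosh /sh !opprD opprK !expRD.
  move: (expR a) (expR (- a)) (expR b) (expR (- b)) ea eb => A A' B B' ea eb.
  suff : (A * B + A' * B') * (A * B' + A' * B) =
    (A + A') ^+ 2 + (B - B') ^+ 2 by lra.
  have -> : (A * B + A' * B') * (A * B' + A' * B) =
    (B * B') * (A ^+ 2 + A' ^+ 2) + (A * A') * (B ^+ 2 + B' ^+ 2) by ring.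
  have -> : (A + A') ^+ 2 + (B - B') ^+ 2 =
    A ^+ 2 + A' ^+ 2 + 2 * (A * A') + (B ^+ 2 + B' ^+ 2) - 2 * (B * B') by ring.
  by rewrite ea eb; ring.
rewrite lerD2l.
have h (c : R) : 0 <= c -> c <= expR c - expR (- c).
  move=> c0; have := expR_ge1Dx c.
  have : expR (- c) <= 1 by rewrite -expR0 ler_expR oppr_le0.
  by lra.
have -> : b ^+ 2 / 4 = (b / 2) ^+ 2 by field.
have [b0|b0] := leP 0 b.
  have hb := h b b0.
  by rewrite lerXn2r ?nnegrE /sh; lra.
have := h (- b); rewrite opprK oppr_ge0 => /(_ (ltW b0)) hb.
by rewrite -[leLHS]sqrrN -[leRHS]sqrrN /sh lerXn2r ?nnegrE; lra.
Qed.

End lncosh.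

(** * Uniform concentration of the empirical function *)

(** With [a = n + 1], the increment [2/a - 2/(a+1)] is at least [1/a^2], so the induction closes. *)
Lemma sum_inv_sq_le {R : realType} n :
  \sum_(0 <= i < n) ((i.+1%:R : R) ^+ 2)^-1 <= 2 - 2 / n.+1%:R.
Proof.
elim: n => [|n ih]; first by rewrite big_geq// invr1; lra.
rewrite big_nat_recr//= (le_trans (lerD ih (lexx _)))//.
have a1 : 1 <= n.+1%:R :> R by rewrite ler1n.
rewrite -(natr1 n.+1); move: (n.+1%:R : R) a1 => a a1.
have -> : 2 - 2 / (a + 1) = 2 - 2 / a + (a ^+ 2)^-1 + (a - 1) / (a ^+ 2 * (a + 1)).
  by field; lra.
rewrite lerDl divr_ge0 ?mulr_ge0 ?sqr_ge0//; lra.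
Qed.

(** Borel-Cantelli: the probabilities are summable, so [lim_sup_set F] is the exceptional null
    set. *)
Lemma ae_eventually_notin {R : realType} d (Omega : measurableType d)
    (P : probability Omega R) (F : nat -> set Omega) (C : R) :
  (forall n, measurable (F n)) ->
  (forall n, P (F n) <= (C / n.+1%:R ^+ 2)%:E)%E ->
  {ae P, forall w, \forall n \near \oo, ~ F n w}.
Proof.
move=> mF FC; exists (lim_sup_set F); split.
- apply: bigcap_measurable => // k _; exact: bigcup_measurable.
- apply: lim_sup_set_cvg0 => //.
  apply: (@le_lt_trans _ _ (`|C| * 2)%:E); last exact: ltry.
  apply: lime_le; first by apply: is_cvg_nneseries => n _ _; exact: measure_ge0.
  near=> n; apply: (@le_trans _ _
    (\sum_(0 <= i < n) (`|C| * (i.+1%:R ^+ 2)^-1)%:E)%E).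
    apply: lee_sum => i _; rewrite (le_trans (FC i))// lee_fin ler_wpM2r//.
    exact: ler_norm.
  rewrite sumEFin lee_fin -mulr_sumr ler_wpM2l//.
  by rewrite (le_trans (sum_inv_sq_le n))// gerBl divr_ge0.
move=> w /= nFw k _; apply: contrapT => nex; apply: nFw.
exists k => // j /= kj Fj; apply: nex; exists j => //.
Unshelve. all: by end_near. Qed.

Section uniform_concentration.
Context {R : realType} (beta : R) (beta_gt0 : 0 < beta) (nu : probability R R).
Context (nu_moment2 : (\int[nu]_x (x ^+ 2)%:E < +oo)%E).

(** The second moment enters here: [|ln cosh z| <= |z|] and [|y| <= 1 + y^2] give an integrable
    majorant. *)
Lemma integrable_lncosh x :
  nu.-integrable setT (EFin \o (fun y => lncosh (beta * (x + y)))).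
Proof.
have i2 : nu.-integrable setT (EFin \o (fun y : R => y ^+ 2)).
  apply/integrableP; split.
    by apply/measurable_EFinP; exact: measurable_funX.
  under eq_integral do rewrite /= ger0_norm ?sqr_ge0//.
  exact: nu_moment2.
have ib : nu.-integrable setT
    (EFin \o (fun y : R => beta * (`|x| + 1) + beta * y ^+ 2)).
  apply: (eq_integrable measurableT
    (cst (beta * (`|x| + 1))%:E \+ (fun y : R => beta%:E * (y ^+ 2)%:E))%E) => //.
  apply: integrableD => //; first exact: finite_measure_integrable_cst.
  exact: integrableZl.
apply: (le_integrable measurableT _ _ ib).
  apply/measurable_EFinP; apply: (measurableT_comp (f := lncosh)).
    exact: measurable_lncosh.
  by apply: measurable_funM => //; exact: measurable_funD.
move=> y _ /=; rewrite lee_fin (le_trans (abs_lncosh_le _))// normrM gtr0_norm//.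
rewrite [leRHS]ger0_norm; last first.
  by apply: addr_ge0; apply: mulr_ge0; rewrite ?sqr_ge0 ?addr_ge0 ?(ltW beta_gt0).
rewrite -mulrDr ler_pM2l// (le_trans (ler_normD _ _))// -addrA lerD2l.
by rewrite -[y ^+ 2]real_normK ?num_real//; nra.
Qed.

Variable m : R.

(** Increments are used because they are bounded by [beta * |t|] uniformly in [y], whereas ln cosh
    itself is unbounded. Hoeffding's inequality thus applies, with an error proportional to
    [|t|]. *)
Definition lncosh_incr (t y : R) :=
  lncosh (beta * (m + t + y)) - lncosh (beta * (m + y)).

Lemma lncosh_incr_lipschitz t u y :
  `|lncosh_incr t y - lncosh_incr u y| <= beta * `|t - u|.
Proof.
rewrite /lncosh_incr opprB addrA subrK (le_trans (lncosh_lipschitz _ _))//.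
have -> : beta * (m + t + y) - beta * (m + u + y) = beta * (t - u) by ring.
by rewrite normrM gtr0_norm.
Qed.

Lemma abs_lncosh_incr_le t y : `|lncosh_incr t y| <= beta * `|t|.
Proof.
have := lncosh_incr_lipschitz t 0 y.
by rewrite /lncosh_incr addr0 subrr !subr0.
Qed.

Lemma measurable_lncosh_incr t : measurable_fun setT (lncosh_incr t).
Proof.
apply: measurable_funB; apply: (measurableT_comp (f := lncosh));
  try exact: measurable_lncosh;
  by apply: measurable_funM => //; exact: measurable_funD.
Qed.

Lemma G_fun_incr t : G_fun beta nu (m + t) - G_fun beta nu m =
  beta / 2 * ((m + t) ^+ 2 - m ^+ 2) - \int[nu]_y lncosh_incr t y.
Proof.
rewrite /G_fun RintegralB//; try exact: integrable_lncosh.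
by rewrite /lncosh; ring.
Qed.

Definition empirical_G (h : nat -> R) n x : R :=
  beta / 2 * x ^+ 2 - (\sum_(i < n) lncosh (beta * (x + h i))) / n%:R.

Lemma empirical_G_incr h n t : empirical_G h n (m + t) - empirical_G h n m =
  beta / 2 * ((m + t) ^+ 2 - m ^+ 2) - (\sum_(i < n) lncosh_incr t (h i)) / n%:R.
Proof. by rewrite /empirical_G sumrB; ring. Qed.

(** The factor [ln n] beyond the central limit scale makes Hoeffding's bound a negative power of
    [n], small enough for a union over the grid and for Borel-Cantelli. *)
Definition fluctuation n : R := Num.sqrt (ln n%:R / n%:R).

Variables (d : measure_display) (Omega : measurableType d)
  (P : probability Omega R) (h : nat -> {RV P >-> R}).
Hypothesis iidh : iid_with_law nu h.

(** The indices [i <= 2 L n] give a grid of mesh [1/n] on [[-L, L]]. *)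
Let grid (L n i : nat) : R := i%:R / n%:R - L%:R.

(** The threshold follows the bound [beta * |t|] on the increments; the extra [1/n] keeps the
    constant in Hoeffding's inequality nonzero at the grid point 0. *)
Let bad_at L n i : set Omega :=
  [set w | 10 * beta * (`|grid L n i| + n%:R^-1) * (n%:R * fluctuation n)
    < `|\sum_(j < n) lncosh_incr (grid L n i) (h j w)
        - n%:R * \int[nu]_y lncosh_incr (grid L n i) y|].

Let bad L n : set Omega := \big[setU/set0]_(i < (2 * L * n).+1) bad_at L n i.

Let measurable_bad_at L n i : measurable (bad_at L n i).
Proof.
have mS : measurable_fun setT (fun w =>
    `|\sum_(j < n) lncosh_incr (grid L n i) (h j w)
        - n%:R * \int[nu]_y lncosh_incr (grid L n i) y|).
  apply: measurableT_comp => //; apply: measurable_funB => //.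
  apply: measurable_sum => j; apply: measurableT_comp => //.
  exact: measurable_lncosh_incr.
rewrite /bad_at; set T := (X in [set w | X < _]).
rewrite -[X in measurable X]setTI.
have -> : [set w | T < `|\sum_(j < n) lncosh_incr (grid L n i) (h j w)
        - n%:R * \int[nu]_y lncosh_incr (grid L n i) y|] =
  (fun w => `|\sum_(j < n) lncosh_incr (grid L n i) (h j w)
        - n%:R * \int[nu]_y lncosh_incr (grid L n i) y|) @^-1` `]T, +oo[.
  by apply/seteqP; split => w /=; rewrite in_itv/= andbT.
exact: mS.
Qed.

Let measurable_bad L n : measurable (bad L n).
Proof. exact: bigsetU_measurable. Qed.

Let fluctuation2 n : (0 < n)%N -> n%:R * fluctuation n ^+ 2 = ln n%:R :> R.
Proof.
move=> n0; have n0' : 0 < n%:R :> R by rewrite ltr0n.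
rewrite /fluctuation sqr_sqrtr; last by rewrite divr_ge0 ?ln_ge0 ?ler1n.
by rewrite mulrC divfK ?gt_eqF.
Qed.

(* With M = beta (|t| + 1/n) and s = fluctuation n / (2 M), Hoeffding's exponent
   is (8/4 - 10/2) ln n = - 3 ln n, summable against the size of the grid. *)
Let bad_le L n : (P (bad L n.+1) <= ((4 * L%:R + 2) / n.+1%:R ^+ 2)%:E)%E.
Proof.
set N := n.+1.
have N0 : 0 < N%:R :> R by rewrite ltr0n.
apply: (@le_trans _ _ (\sum_(i < (2 * L * N).+1) (2 * N%:R ^- 3)%:E)%E).
  apply: (le_trans (@le_mu_bigsetU _ _ _ P (bad_at L N) _ _)) => //.
  apply: lee_sum => i _.
  pose M := beta * (`|grid L N i| + N%:R^-1).
  have M0 : 0 < M by rewrite mulr_gt0// ltr_wpDl ?invr_gt0.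
  have s0 : 0 <= fluctuation N / (2 * M).
    by rewrite divr_ge0 ?sqrtr_ge0// mulr_ge0// ltW.
  apply: le_trans (hoeffding (M := M) _ _ iidh (measurable_lncosh_incr _) _ s0) _.
    move=> y; rewrite (le_trans (abs_lncosh_incr_le _ _))// ler_pM2l// lerDl.
    by rewrite invr_ge0 ler0n.
  rewrite lee_fin ler_pM2l//.
  have -> : N%:R ^- 3 = expR (- (3 * ln N%:R)) :> R.
    by rewrite expRN [3 * _]mulrC expRM_natr lnK.
  rewrite ler_expR -fluctuation2// -/M.
  have -> : 10 * beta * (`|grid L N i| + N%:R^-1) = 10 * M by rewrite /M; ring.
  by rewrite le_eqVlt; apply/orP; left; apply/eqP; field; lra.
rewrite sumEFin lee_fin sumr_const card_ord -[leLHS]mulr_natr.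
rewrite -(natr1 (2 * L * N)%N) natrM natrM.
have N1 : 1 <= N%:R :> R by rewrite ler1n.
rewrite -subr_ge0.
have -> : (4 * L%:R + 2) / N%:R ^+ 2 - 2 / N%:R ^+ 3 * (2 * L%:R * N%:R + 1)
  = 2 * (N%:R - 1) / N%:R ^+ 3 :> R by field; lra.
by rewrite divr_ge0 ?exprn_ge0 ?ler0n// mulr_ge0//; lra.
Qed.

Lemma empirical_G_concentration (L : nat) :
  {ae P, forall w, \forall n \near \oo, forall t, `|t| <= L%:R ->
    `|(empirical_G (h^~ w) n (m + t) - empirical_G (h^~ w) n m)
      - (G_fun beta nu (m + t) - G_fun beta nu m)|
    <= 22 * beta * (`|t| * fluctuation n + n%:R^-1)}.
Proof.
have := ae_eventually_notin (fun n => measurable_bad L n.+1) (bad_le L).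
(* The bad events are indexed from [n = 1], which shifts the threshold by one and leaves out
   [n = 0]. *)
apply: filterS => w [k _ hk]; exists k.+1 => // -[//|n] /= kn t tL.
have {hk} := hk n kn; set N := n.+1 => nbad.
have N0 : 0 < N%:R :> R by rewrite ltr0n.
rewrite empirical_G_incr G_fun_incr.
set S := \sum_(i < _) _; set I := \int[nu]_y _.
have -> : beta / 2 * ((m + t) ^+ 2 - m ^+ 2) - S / N%:R -
   (beta / 2 * ((m + t) ^+ 2 - m ^+ 2) - I) = - (S / N%:R - I) by ring.
rewrite normrN.
have tL0 : 0 <= (t + L%:R) * N%:R.
  by rewrite mulr_ge0 ?(ltW N0)//; move: tL; rewrite ler_norml; lra.
(* [grid L N i] is the grid point just below [t]. *)
pose i := Num.trunc ((t + L%:R) * N%:R).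
have /andP[i_le i_gt] := truncn_itv tL0.
have i_bound : (i < (2 * L * N).+1)%N.
  rewrite ltnS -(ler_nat R) (le_trans i_le)// !natrM ler_pM2r//.
  by move: tL; rewrite ler_norml; lra.
have absiN : `|N%:R^-1 : R| = N%:R^-1 by rewrite gtr0_norm ?invr_gt0.
set g := grid L N i.
have tg : `|t - g| <= N%:R^-1.
  have -> : t - g = ((t + L%:R) * N%:R - i%:R) / N%:R.
    by rewrite /g /grid; field; lra.
  rewrite normrM absiN ler_pdivrMr// mulVf ?gt_eqF//.
  by rewrite ger0_norm; [move: i_gt; rewrite -(natr1 i); lra|lra].
have gt_le : `|g| <= `|t| + N%:R^-1.
  have := ler_normB t (t - g); have -> : t - (t - g) = g by ring.
  by lra.
have : ~ bad_at L N i w.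
  by move=> h'; apply: nbad; rewrite /bad (bigD1 (Ordinal i_bound))//=; left.
rewrite /bad_at /= => /negP; rewrite -leNgt -/g.
set S' := \sum_(i < _) _; set I' := \int[nu]_y _ => S'I'.
have SS' : `|S - S'| <= beta.
  rewrite /S /S' -sumrB (le_trans (ler_norm_sum _ _ _))//.
  apply: (@le_trans _ _ (\sum_(i < N) (beta * N%:R^-1))).
    apply: ler_sum => j _; rewrite (le_trans (lncosh_incr_lipschitz _ _ _))//.
    by rewrite ler_pM2l.
  by rewrite sumr_const card_ord -[leLHS]mulr_natr divfK// gt_eqF.
have II' : `|I' - I| <= beta / N%:R.
  have bi u : nu.-integrable setT (EFin \o lncosh_incr u).
    apply: (bounded_integrable nu (measurable_lncosh_incr u)) => y.
    exact: abs_lncosh_incr_le.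
  rewrite /I /I' -RintegralB//.
  have ib : nu.-integrable setT
      (EFin \o (fun y => lncosh_incr g y - lncosh_incr t y)).
    exact: (integrableB measurableT (bi g) (bi t)).
  apply: (le_trans (le_normr_Rintegral measurableT ib)).
  have -> : beta / N%:R = \int[nu]_y (beta / N%:R).
    rewrite Rintegral_cst// [X in fine X](_ : _ = 1%E) ?mulr1//.
    exact: probability_setT.
  apply: le_Rintegral => //.
  - exact: (integrable_norm ib).
  - exact: finite_measure_integrable_cst.
  - move=> y _; rewrite (le_trans (lncosh_incr_lipschitz _ _ _))//.
    by rewrite distrC ler_pM2l.
have fl1 : fluctuation N <= 1.
  rewrite /fluctuation -[leRHS]sqrtr1 ler_sqrt//.
  by rewrite ler_pdivrMr// mul1r ltW// ln_sublinear.
have fl0 : 0 <= fluctuation N := sqrtr_ge0 _.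
(* Two discretization errors of size [beta / N] surround the deviation at [g], which is at most
   [10 beta (|t| fluctuation + 2 / N)]. The [1/N] terms add up to [22 beta / N], and 22 serves for
   both kinds of terms. *)
have -> : S / N%:R - I = (S - S') / N%:R + (S' - N%:R * I') / N%:R + (I' - I).
  by field; lra.
rewrite (le_trans (ler_normD _ _))// (le_trans (lerD (ler_normD _ _) (lexx _)))//.
rewrite !normrM absiN.
have iN0 : 0 < N%:R^-1 :> R by rewrite invr_gt0.
have h1 : `|S - S'| / N%:R <= beta / N%:R by rewrite ler_pM2r.
have h2 : `|S' - N%:R * I'| / N%:R <= 10 * beta * (`|g| + N%:R^-1) * fluctuation N.
  rewrite ler_pdivrMr// (le_trans S'I')//.
  by rewrite le_eqVlt; apply/orP; left; apply/eqP; ring.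
have h3 : (`|g| + N%:R^-1) * fluctuation N <= `|t| * fluctuation N + 2 / N%:R.
  have : (`|g| + N%:R^-1) * fluctuation N <= (`|t| + 2 / N%:R) * fluctuation N.
    by rewrite ler_wpM2r//; lra.
  move/le_trans; apply; rewrite mulrDl lerD2l ler_piMr//.
have h4 := ler_wpM2l (ltW beta_gt0) h3.
have h5 : 0 <= beta * (`|t| * fluctuation N).
  by rewrite mulr_ge0 ?(ltW beta_gt0)// mulr_ge0.
by move: h1 h2 II' h4 h5; lra.
Qed.

End uniform_concentration.

(** * Exponentially tilted spins *)

Section tilting.
Context {R : realType} (beta : R) (beta_gt0 : 0 < beta).
Context (h : nat -> R) (n : nat).
Hypothesis n_gt0 : (0 < n)%N.
Implicit Types (s : n.-tuple bool) (x t : R).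

Local Notation Gn := (empirical_G beta h n).

Definition magnetization s : R := total_spin s / n%:R.

(* The law of n independent spins in the external fields x + h_i. *)
Definition tilted_pmf x s : R :=
  expR (beta * \sum_(i < n) (x + h i) * spin (tnth s i)) /
  \prod_(i < n) (2 * cosh (beta * (x + h i))).

Let n0 : 0 < n%:R :> R. Proof. by rewrite ltr0n. Qed.

Let prod_gt0 x : 0 < \prod_(i < n) (2 * cosh (beta * (x + h i))).
Proof. by apply: prodr_gt0 => i _; rewrite mulr_gt0// cosh_gt0. Qed.

Lemma tilted_pmf_ge0 x s : 0 <= tilted_pmf x s.
Proof. by rewrite divr_ge0 ?expR_ge0// ltW. Qed.

(** The exponential factorizes over the sites, and expanding the product of two-term sums produces
    the sum over all configurations. *)
Lemma sum_tilted_pmf x : \sum_s tilted_pmf x s = 1.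
Proof.
rewrite /tilted_pmf -mulr_suml.
suff -> : \sum_s expR (beta * \sum_(i < n) (x + h i) * spin (tnth s i)) =
    \prod_(i < n) (2 * cosh (beta * (x + h i))).
  by rewrite divff// gt_eqF.
pose F (i : 'I_n) (b : bool) := expR (beta * (x + h i) * spin b).
transitivity (\prod_(i < n) \sum_(b : bool) F i b); last first.
  apply: eq_bigr => i _; rewrite big_bool /F/= mulr1 mulrN1 /cosh.
  by rewrite [RHS]mulrC divfK.
rewrite bigA_distr_bigA/=.
rewrite (reindex (fun f : {ffun 'I_n -> bool} => tuple_of_finfun f))/=; last first.
  exists (@finfun_of_tuple _ _) => f _.
    exact: tuple_of_finfunK.
  exact: finfun_of_tupleK.
apply: eq_bigr => f _; rewrite mulr_sumr expR_sum; apply: eq_bigr => i _.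
by rewrite /F tnth_mktuple mulrA.
Qed.

(** With [u] the magnetization, [u^2 / 2 = x u - x^2 / 2 + (u - x)^2 / 2]: the linear term shifts
    every field by [x], and the normalization of the product law together with [x^2] forms
    [Gn x]. *)
Lemma gibbs_weight_tilt x s : gibbs_weight beta h s =
  2 ^+ n * expR (- (n%:R * Gn x)) *
  expR (n%:R * (beta / 2) * (magnetization s - x) ^+ 2) * tilted_pmf x s.
Proof.
rewrite /tilted_pmf big_split/= prodr_const card_ord.
have -> : \prod_(i < n) cosh (beta * (x + h i)) =
    expR (\sum_(i < n) lncosh (beta * (x + h i))).
  by rewrite expR_sum; apply: eq_bigr => i _; rewrite lnK// posrE cosh_gt0.
rewrite invfM -expRN; set L := \sum_(i < n) lncosh _.
have -> : - (n%:R * Gn x) = L - n%:R * (beta / 2) * x ^+ 2.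
  by rewrite /empirical_G -/L; field; rewrite (gt_eqF n0).
set a := expR _; rewrite mulrA.
rewrite [RHS](_ : _ = (2 ^+ n / 2 ^+ n) *
  (a * expR (n%:R * (beta / 2) * (magnetization s - x) ^+ 2) *
  expR (beta * \sum_(i < n) (x + h i) * spin (tnth s i)) * expR (- L))); last by ring.
rewrite divff ?expf_neq0// mul1r /a -!expRD; congr expR.
have -> : \sum_(i < n) (x + h i) * spin (tnth s i) =
    x * total_spin s + \sum_(i < n) h i * spin (tnth s i).
  rewrite /total_spin mulr_sumr -big_split.
  by apply: eq_bigr => i _; rewrite mulrDl.
by rewrite /magnetization; field; rewrite (gt_eqF n0).
Qed.

Lemma tilted_pmf_change x t s : tilted_pmf x s = tilted_pmf (x + t) s *
  expR (n%:R * (Gn x - Gn (x + t) - beta * (t * (magnetization s - x))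
                + beta / 2 * t ^+ 2)).
Proof.
(* The Gibbs weight does not depend on the tilt, so its decompositions at [x] and [x + t] can be
   equated. *)
have := gibbs_weight_tilt x s; rewrite (gibbs_weight_tilt (x + t)).
set u := magnetization s => E.
have c0 : 0 < 2 ^+ n * expR (- (n%:R * Gn x)) *
    expR (n%:R * (beta / 2) * (u - x) ^+ 2).
  by rewrite !mulr_gt0 ?expR_gt0// exprn_gt0.
apply: (mulfI (lt0r_neq0 c0)); rewrite -E.
set p := tilted_pmf _ _; clear E.
rewrite [RHS](_ : _ = 2 ^+ n * p * (expR (- (n%:R * Gn x)) *
  expR (n%:R * (beta / 2) * (u - x) ^+ 2) * expR (n%:R * (Gn x - Gn (x + t)
   - beta * (t * (u - x)) + beta / 2 * t ^+ 2)))); last by ring.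
rewrite [LHS](_ : _ = 2 ^+ n * p * (expR (- (n%:R * Gn (x + t))) *
  expR (n%:R * (beta / 2) * (u - (x + t)) ^+ 2))); last by ring.
by rewrite -!expRD; congr (_ * expR _); field.
Qed.

(** Chernoff's bound by change of tilt: on the event the density with respect to the tilt [x + t] is
    at most the right-hand side, and that tilted law has mass one. *)
Lemma tilted_tail x t c :
  \sum_(s | c <= t * (magnetization s - x)) tilted_pmf x s <=
  expR (n%:R * (Gn x - Gn (x + t) - beta * c + beta / 2 * t ^+ 2)).
Proof.
pose E := expR (n%:R * (Gn x - Gn (x + t) - beta * c + beta / 2 * t ^+ 2)).
apply: (@le_trans _ _ (\sum_s tilted_pmf (x + t) s * E)); last first.
  by rewrite -mulr_suml sum_tilted_pmf mul1r.
rewrite [leRHS](bigID (fun s => c <= t * (magnetization s - x)))/=.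
rewrite ler_wpDr//.
  by apply: sumr_ge0 => s _; rewrite mulr_ge0 ?expR_ge0// tilted_pmf_ge0.
apply: ler_sum => s cs; rewrite (tilted_pmf_change x t).
rewrite ler_wpM2l ?tilted_pmf_ge0// ler_expR ler_pM2l// lerD2r lerB//.
by rewrite ler_pM2l.
Qed.

(** Counting the spins [+1] shows that the magnetization takes at most [n + 1] values. *)
Lemma magnetization_count s :
  magnetization s = (2 * (\sum_(i < n) tnth s i)%N%:R - n%:R) / n%:R.
Proof.
congr (_ / _); rewrite /total_spin natr_sum mulr_sumr.
have -> : n%:R = \sum_(i < n) (1 : R) by rewrite sumr_const card_ord.
rewrite -sumrB; apply: eq_bigr => i _.
by case: (tnth s i) => /=; rewrite /spin; lra.
Qed.

Lemma abs_magnetization_le1 s : `|magnetization s| <= 1.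
Proof.
rewrite normrM [X in _ * X]gtr0_norm ?invr_gt0// ler_pdivrMr// mul1r.
rewrite (le_trans (ler_norm_sum _ _ _))//.
have -> : n%:R = \sum_(i < n) (1 : R) by rewrite sumr_const card_ord.
by apply: ler_sum => i _; rewrite /spin; case: ifP; rewrite ?normrN normr1.
Qed.

(* The tilt tau may depend on the configuration through its magnetization, which
   takes at most n + 1 values; hence the factor n + 1. *)
Lemma sum_gibbs_weight_le (A : pred (n.-tuple bool)) (tau : R -> R) (m E : R) :
  (forall s, A s -> E <= n%:R * (Gn (tau (magnetization s)) - Gn m)
     - n%:R * (beta / 2) * (magnetization s - tau (magnetization s)) ^+ 2) ->
  \sum_(s | A s) gibbs_weight beta h s <=
  2 ^+ n * expR (- (n%:R * Gn m)) * (n.+1%:R * expR (- E)).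
Proof.
move=> hE.
pose Z0 : R := 2 ^+ n * expR (- (n%:R * Gn m)).
have Z0_ge0 : 0 <= Z0 by rewrite mulr_ge0 ?expR_ge0// exprn_ge0.
pose u (j : nat) : R := (2 * j%:R - n%:R) / n%:R.
pose cnt s := (\sum_(i < n) tnth s i)%N.
have cntP s : (cnt s < n.+1)%N.
  rewrite ltnS (@leq_trans (\sum_(i < n) 1)%N)//; last first.
    by rewrite sum1_card card_ord.
  by apply: leq_sum => i _; exact: leq_b1.
have mE s : magnetization s = u (cnt s) by rewrite magnetization_count.
(* Each weight is bounded by its single term [j = cnt s]; adding the other [j] makes the tilt
   independent of [s], so that each inner sum over [s] is one. *)
apply: (@le_trans _ _
  (\sum_s \sum_(j < n.+1) Z0 * expR (- E) * tilted_pmf (tau (u j)) s)).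
  rewrite [leRHS](bigID A)/= ler_wpDr//.
    apply: sumr_ge0 => s _; apply: sumr_ge0 => j _.
    by rewrite mulr_ge0 ?tilted_pmf_ge0// mulr_ge0// expR_ge0.
  apply: ler_sum => s As; rewrite (bigD1 (Ordinal (cntP s)))//= -mE ler_wpDr//.
    apply: sumr_ge0 => j _.
    by rewrite mulr_ge0 ?tilted_pmf_ge0// mulr_ge0// expR_ge0.
  rewrite (gibbs_weight_tilt (tau (magnetization s))) ler_wpM2r ?tilted_pmf_ge0//.
  rewrite /Z0 -!mulrA ler_pM2l ?exprn_gt0// -!expRD ler_expR.
  by have := hE s As; lra.
rewrite exchange_big/= [leRHS](_ : _ = \sum_(j < n.+1) Z0 * expR (- E)).
  by apply: ler_sum => j _; rewrite -mulr_sumr sum_tilted_pmf mulr1.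
by rewrite sumr_const card_ord -[RHS]mulr_natl mulrCA.
Qed.

Lemma partition_function_ge m :
  2 ^+ n * expR (- (n%:R * Gn m)) <= partition_function beta h n.
Proof.
rewrite [leLHS](_ : _ =
  \sum_s 2 ^+ n * expR (- (n%:R * Gn m)) * tilted_pmf m s); last first.
  by rewrite -mulr_sumr sum_tilted_pmf mulr1.
apply: ler_sum => s _; rewrite (gibbs_weight_tilt m) ler_wpM2r ?tilted_pmf_ge0//.
rewrite ler_peMr ?mulr_ge0 ?expR_ge0 ?exprn_ge0// -expR0 ler_expR.
by rewrite mulr_ge0 ?sqr_ge0// mulr_ge0 ?divr_ge0 ?ler0n// ltW.
Qed.

End tilting.

(** * Speed and radius of the window *)

Section power_growth.
Context {R : realType}.
Implicit Types (p e M : R).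

Lemma near_powR_ge p M : 0 < p -> \forall n \near \oo, M <= n%:R `^ p :> R.
Proof.
move=> p0; have [M0|M0] := leP M 0.
  by apply: nearW => n; rewrite (le_trans M0)// powR_ge0.
near=> n.
have -> : M = (M `^ p^-1) `^ p by rewrite -powRrM mulVf ?gt_eqF// powRr1// ltW.
rewrite ge0_ler_powR ?nnegrE ?powR_ge0 ?ler0n ?(ltW p0)//.
by near: n; exact: nbhs_infty_ger.
Unshelve. all: by end_near. Qed.

Lemma ln_le_powR p n : 0 < p -> (0 < n)%N -> p * ln n%:R <= n%:R `^ p :> R.
Proof.
move=> p0 n0; rewrite -ln_powR; apply/ltW/ln_sublinear.
by rewrite powR_gt0 // ltr0n.
Qed.

(** Half of the power dominates the logarithm, and the other half the constant. *)
Lemma near_ln_le p e : 0 < p -> 0 < e ->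
  \forall n \near \oo, ln n%:R <= e * n%:R `^ p :> R.
Proof.
move=> p0 e0; have p20 : 0 < p / 2 by rewrite divr_gt0.
near=> n.
have n0 : (0 < n)%N by near: n; exists 1%N.
have h1 := ln_le_powR p20 n0.
have h2 : (e * (p / 2))^-1 <= n%:R `^ (p / 2) by near: n; exact: near_powR_ge.
have -> : n%:R `^ p = n%:R `^ (p / 2) * n%:R `^ (p / 2) :> R.
  by rewrite -powRD -?splitr//; apply/implyP; rewrite pnatr_eq0 -lt0n n0.
rewrite -(ler_pM2l p20) (le_trans h1)//.
set w := _ `^ _ in h2 *.
have w0 : 0 < w by rewrite powR_gt0 // ltr0n.
move: h2; rewrite -[_^-1]mul1r ler_pdivrMr ?mulr_gt0// => h2.
by rewrite mulrA mulrA -[leLHS]mul1r ler_pM2r//; lra.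
Unshelve. all: by end_near. Qed.

Lemma near_lnS_le p e : 0 < p -> 0 < e ->
  \forall n \near \oo, ln n.+1%:R <= e * n%:R `^ p :> R.
Proof.
move=> p0 e0; have e20 : 0 < e / 2 by rewrite divr_gt0.
near=> n.
have n0 : (0 < n)%N by near: n; exists 1%N.
have h1 : ln n%:R <= e / 2 * n%:R `^ p :> R by near: n; exact: near_ln_le.
have h2 : ln 2 / (e / 2) <= n%:R `^ p :> R by near: n; exact: near_powR_ge.
apply: (@le_trans _ _ (ln (2 * n%:R))).
  rewrite ler_ln ?posrE ?mulr_gt0 ?ltr0n// -natrM ler_nat.
  by rewrite mul2n -addnn -addn1 leq_add2l.
rewrite lnM ?posrE ?ltr0n//; move: h2; rewrite ler_pdivrMr//; lra.
Unshelve. all: by end_near. Qed.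

Lemma near_fluctuation_small e : 0 < e ->
  \forall n \near \oo, fluctuation n <= e :> R.
Proof.
move=> e0; near=> n.
have n0 : (0 < n)%N by near: n; exists 1%N.
have n0' : 0 < n%:R :> R by rewrite ltr0n.
have h : ln n%:R <= e ^+ 2 * n%:R `^ 1 :> R.
  by near: n; apply: near_ln_le => //; rewrite exprn_gt0.
rewrite -(ger0_norm (ltW e0)) -sqrtr_sqr ler_sqrt ?sqr_ge0//.
by rewrite ler_pdivrMr// -[X in _ * X]powRr1// ltW.
Unshelve. all: by end_near. Qed.

End power_growth.

Section scaling.
Context {R : realType} (k : nat) (alpha : R).
Hypotheses (k_gt0 : (1 <= k)%N)
  (alpha_range : 1 - 1 / (2 * (2 * k%:R - 1)) < alpha < 1).

Definition speed n : R := n%:R `^ (1 - 2 * k%:R * (1 - alpha)).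
(** Deviations of [S_n] of order [n^alpha] are deviations of the magnetization of order [radius n];
    the speed is then [n * radius n ^+ (2 * k)]. *)
Definition radius n : R := n%:R `^ (alpha - 1).

Let k1 : 1 <= k%:R :> R. Proof. by rewrite ler1n. Qed.

(* The lower bound on alpha says exactly that this exponent is positive; it makes
   the random fluctuations of order n^(-1/2) negligible on the window. *)
Let gap : 0 < (2 * k%:R - 1) * alpha - 2 * k%:R + 3 / 2 :> R.
Proof.
have /andP[h _] := alpha_range.
have k21 : 0 < 2 * k%:R - 1 :> R by have := k1; lra.
have := ltr_pM2l k21 (1 - 1 / (2 * (2 * k%:R - 1))) alpha; rewrite h.
have -> : (2 * k%:R - 1) * (1 - 1 / (2 * (2 * k%:R - 1))) = 2 * k%:R - 3 / 2 :> R.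
  by field; lra.
by lra.
Qed.

Let alpha_lt1 : alpha < 1. Proof. by case/andP: alpha_range. Qed.

Let alpha_gt : 1 / 2 < alpha.
Proof. have := gap; have := k1; have := alpha_lt1; nra. Qed.

(** This exponent is the sum of the one in [gap] and of [alpha - 1/2]. *)
Lemma speed_exponent_gt0 : 0 < 1 - 2 * k%:R * (1 - alpha).
Proof. have := gap; have := alpha_gt; lra. Qed.

Let mul_radiusX n j : (0 < n)%N ->
  n%:R * radius n ^+ j = n%:R `^ (1 + (alpha - 1) * j%:R) :> R.
Proof.
move=> n0; rewrite powRD ?powRr1 ?ler0n//.
  by rewrite powRrM powR_mulrn ?powR_ge0.
by apply/implyP; rewrite pnatr_eq0 -lt0n n0.
Qed.

Lemma mul_radius n : (0 < n)%N -> n%:R * radius n = n%:R `^ alpha.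
Proof.
by move=> n0; rewrite -[radius n]expr1 mul_radiusX//; congr (_ `^ _); ring.
Qed.

Lemma speedE n : (0 < n)%N -> speed n = n%:R * radius n ^+ (2 * k).
Proof. by move=> n0; rewrite mul_radiusX// natrM; congr (_ `^ _); ring. Qed.

Lemma radius_gt0 n : (0 < n)%N -> 0 < radius n.
Proof. by move=> n0; rewrite powR_gt0// ltr0n. Qed.

Lemma speed_gt0 n : (0 < n)%N -> 0 < speed n.
Proof. by move=> n0; rewrite powR_gt0// ltr0n. Qed.

Lemma near_speed_ge M : \forall n \near \oo, M <= speed n.
Proof. by apply: near_powR_ge; exact: speed_exponent_gt0. Qed.

Lemma near_radius_le e : 0 < e -> \forall n \near \oo, radius n <= e.
Proof.
move=> e0; near=> n.
have n0 : (0 < n)%N by near: n; exists 1%N.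
rewrite /radius -opprB powRN invf_ple ?posrE ?powR_gt0 ?ltr0n//.
by near: n; apply: near_powR_ge; rewrite subr_gt0 alpha_lt1.
Unshelve. all: by end_near. Qed.

Lemma near_lnS_speed e : 0 < e -> \forall n \near \oo, ln n.+1%:R <= e * speed n.
Proof. by move=> e0; apply: near_lnS_le => //; exact: speed_exponent_gt0. Qed.

(** The ratio of the two sides is of order [n^(-g) sqrt (ln n)] with [g > 0] the exponent in [gap];
    squaring removes the root. *)
Lemma near_fluctuation_le e : 0 < e ->
  \forall n \near \oo, n%:R * (radius n * fluctuation n) <= e * speed n.
Proof.
move=> e0; near=> n.
have n0 : (0 < n)%N by near: n; exists 1%N.
have n0' : 0 < n%:R :> R by rewrite ltr0n.
have hl : ln n%:R <=
    e ^+ 2 * n%:R `^ (2 * ((2 * k%:R - 1) * alpha - 2 * k%:R + 3 / 2)).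
  near: n; apply: near_ln_le; rewrite ?exprn_gt0//.
  by rewrite mulr_gt0// gap.
have ln0 : 0 <= ln n%:R :> R by rewrite ln_ge0// ler1n.
rewrite -(@ler_sqr R) ?nnegrE; last 2 first.
- by rewrite !mulr_ge0 ?sqrtr_ge0 ?ler0n ?powR_ge0.
- by rewrite mulr_ge0 ?powR_ge0// ltW.
rewrite !exprMn sqr_sqrtr ?divr_ge0//.
have -> : speed n ^+ 2 = n%:R * radius n ^+ 2 *
    n%:R `^ (2 * ((2 * k%:R - 1) * alpha - 2 * k%:R + 3 / 2)).
  rewrite mul_radiusX// -powRD; last by apply/implyP => _; rewrite gt_eqF.
  rewrite /speed -powR_mulrn ?powR_ge0// -powRrM.
  by congr (_ `^ _); field.
have -> : n%:R ^+ 2 * (radius n ^+ 2 * (ln n%:R / n%:R)) =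
    n%:R * radius n ^+ 2 * ln n%:R by field; rewrite gt_eqF.
by rewrite [leRHS]mulrCA ler_wpM2l// mulr_ge0 ?sqr_ge0.
Unshelve. all: by end_near. Qed.

(** For [k >= 2] the Gaussian scale [n r^2] of independent spins outgrows the speed [n r^(2k)],
    since [r] tends to 0. *)
Lemma near_radius2_ge M : (2 <= k)%N ->
  \forall n \near \oo, M * speed n <= n%:R * radius n ^+ 2.
Proof.
move=> k2; near=> n.
have n0 : (0 < n)%N by near: n; exists 1%N.
have n0' : 0 < n%:R :> R by rewrite ltr0n.
have -> : n%:R * radius n ^+ 2 = n%:R `^ ((2 * k%:R - 2) * (1 - alpha)) * speed n.
  rewrite mul_radiusX// -powRD; last by apply/implyP => _; rewrite gt_eqF.
  by congr (_ `^ _); ring.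
rewrite ler_wpM2r ?powR_ge0//; near: n; apply: near_powR_ge.
have : 2 <= k%:R :> R by rewrite ler_nat.
by have := alpha_lt1; nra.
Unshelve. all: by end_near. Qed.

End scaling.

(** * The function G near and away from its minimum *)

Lemma type_strength_expansion {R : realType} (f : R -> R) m k lambda :
  type_strength f m k lambda -> exists M e, [/\ 0 < e, 0 <= M &
    forall t, `|t| <= e ->
      `|f (m + t) - f m - lambda / ((2 * k)`!)%:R * t ^+ (2 * k)|
        <= M * `|t| ^+ (2 * k).+1].
Proof.
move=> [k0 l0 /eqaddOE/eqaddOP hO].
have [M [M0 hM]] : exists M : R, 0 < M /\ \forall x \near m,
    `|(f - (fun x => f m + lambda / ((2 * k)`!)%:R * (x - m) ^+ (2 * k))) x|
      <= M * `|(x - m) ^+ (2 * k).+1|.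
  case: hO => N [_ hN]; exists (`|N| + 1); split; first by rewrite ltr_wpDl.
  by apply: hN; rewrite ltr_pwDr// ler_norm.
move: hM => /nbhs_ballP[e /= e0 he].
exists M, (e / 2); split; [by rewrite divr_gt0|exact: ltW|].
move=> t te; have := he (m + t).
have mt : ball m e (m + t).
  rewrite /ball /= opprD addNKr normrN; apply: le_lt_trans te _.
  by rewrite ltr_pdivrMr// mulr2n mulrDr mulr1; lra.
move=> /(_ mt) /=.
rewrite !fctE /= [m + t - m]addrC addKr normrX.
by rewrite opprD addrA.
Qed.

(** Otherwise [f] would vanish almost everywhere, and positivity would put the whole space into a
    null set. *)
Lemma Rintegral_gt0 {R : realType} d (T : measurableType d)
    (P : probability T R) (f : T -> R) :
  P.-integrable setT (EFin \o f) -> (forall x, 0 < f x) ->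
  0 < \int[P]_x f x.
Proof.
move=> fint f0; rewrite lt_neqAle Rintegral_ge0; last by move=> x _; exact: ltW.
rewrite andbT; apply/eqP => f_eq0.
have int0 : (\int[P]_x `|(EFin \o f) x| = 0)%E.
  under eq_integral do rewrite /= gtr0_norm//.
  rewrite -[LHS]fineK; first by congr EFin; exact/esym.
  exact: (integrable_fin_num measurableT fint).
have [/(_ int0) [N [mN N0 subN]] _] :=
  ae_eq_integral_abs P measurableT (measurable_int _ fint).
have : (P setT <= P N)%E.
  apply: le_measure; [exact: mem_set|exact: mem_set|move=> x _].
  apply: subN => /= /(_ I) [fx0].
  by have := f0 x; rewrite fx0 ltxx.
by rewrite N0 probability_setT lee_fin ler10.
Qed.

Lemma ln_ge_frac {R : realType} (w : R) : 0 <= w -> w / (1 + w) <= ln (1 + w).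
Proof.
move=> w0; have w1 : 0 < 1 + w by lra.
have -> : ln (1 + w) = - ln (1 + (- (w / (1 + w)))).
  have -> : 1 + - (w / (1 + w)) = (1 + w)^-1 by field; lra.
  by rewrite lnV ?opprK// posrE.
rewrite lerNr le_ln1Dx// ltrN2 ltr_pdivrMr//; lra.
Qed.

Lemma cosh_ge1 {R : realType} (x : R) : 1 <= cosh x.
Proof.
rewrite /cosh ler_pdivlMr// mul1r.
by have := expR_ge1Dx x; have := expR_ge1Dx (- x); lra.
Qed.

Section G_properties.
Context {R : realType} (beta : R) (beta_gt0 : 0 < beta) (nu : probability R R).
Context (nu_moment2 : (\int[nu]_x (x ^+ 2)%:E < +oo)%E).

Lemma integrable_lncosh_incr x t :
  nu.-integrable setT (EFin \o lncosh_incr beta x t).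
Proof.
apply: (bounded_integrable nu (measurable_lncosh_incr beta x t)) => y.
exact: abs_lncosh_incr_le.
Qed.

Lemma abs_integral_lncosh_incr_le x t :
  `|\int[nu]_y lncosh_incr beta x t y| <= beta * `|t|.
Proof.
apply: (le_trans (le_normr_Rintegral measurableT (integrable_lncosh_incr x t))).
have -> : beta * `|t| = \int[nu]_y (beta * `|t|).
  rewrite Rintegral_cst// [X in fine X](_ : _ = 1%E) ?mulr1//.
  exact: probability_setT.
apply: le_Rintegral => //.
- exact: (integrable_norm (integrable_lncosh_incr x t)).
- exact: finite_measure_integrable_cst.
- by move=> y _; exact: abs_lncosh_incr_le.
Qed.

(** Up to its quadratic term, G is Lipschitz with constant [beta] by the bound on the increments. *)
Lemma continuous_G_fun : continuous (G_fun beta nu).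
Proof.
move=> x.
have -> : G_fun beta nu = (fun z : R => beta / 2 * z ^+ 2 -
    (beta / 2 * z ^+ 2 - G_fun beta nu z)).
  by apply/funext => z; ring.
apply: cvgB.
  by apply: cvgM; [exact: cvg_cst|exact: exprn_continuous].
apply/cvgrPdist_le => e e0; near=> z.
have := G_fun_incr beta_gt0 nu_moment2 x (z - x); rewrite subrKC => Gz.
have := abs_integral_lncosh_incr_le x (z - x).
set I := \int[nu]_y _ in Gz * => hI.
have -> : beta / 2 * x ^+ 2 - G_fun beta nu x -
    (beta / 2 * z ^+ 2 - G_fun beta nu z) = - I.
  by move: (G_fun _ _ z) (G_fun _ _ x) Gz {hI} => Gz Gx; move: I => I hG; lra.
rewrite normrN (le_trans hI)// -ler_pdivlMl// distrC.
near: z; apply: cvgr_dist_le; first exact: cvg_id.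
by rewrite mulr_gt0 ?invr_gt0.
Unshelve. all: by end_near. Qed.

(** By continuity G attains its minimum on [[m + e, m + L]] and on [[m - L, m - e]]; both minima
    exceed [G m] because the minimizer is unique. *)
Lemma G_fun_gap m e L : pure_centered beta nu m -> 0 < e ->
  exists2 c, 0 < c & forall t, e <= `|t| <= L ->
    c <= G_fun beta nu (m + t) - G_fun beta nu m.
Proof.
move=> Gmin e0; have [Le|eL] := ltP L e.
  exists 1 => // t /andP[et tL].
  by have := le_lt_trans (le_trans et tL) Le; rewrite ltxx.
have cG a b : {within `[a, b], continuous (G_fun beta nu)}.
  by apply: continuous_subspaceT; exact: continuous_G_fun.
have {Gmin} : unique_global_min (G_fun beta nu) m := Gmin.
move: (G_fun beta nu) cG => g cG Gmin.
have [|u] := @EVT_min R g (m + e) (m + L) _ (cG _ _); first by rewrite lerD2l.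
rewrite in_itv/= => /andP[u_ge _] hu.
have [|v] := @EVT_min R g (m - L) (m - e) _ (cG _ _); first by rewrite lerD2l lerN2.
rewrite in_itv/= => /andP[_ v_le] hv.
have gu : g m < g u by apply: Gmin; rewrite gt_eqF//; lra.
have gv : g m < g v by apply: Gmin; rewrite lt_eqF//; lra.
exists (Num.min (g u - g m) (g v - g m)).
  by rewrite lt_min !subr_gt0 gu.
move=> t tL; rewrite ge_min !lerD2r; have [t0|t0] := leP 0 t.
  by rewrite hu// in_itv/=; move: tL; rewrite ger0_norm// !lerD2l.
rewrite hv ?orbT// in_itv/=; move: tL; rewrite ltr0_norm// => /andP[et tL].
by apply/andP; split; lra.
Qed.

(* The second difference of G at m is beta t^2 minus the integral of the second
   difference of ln cosh, which is at least a positive multiple of t^2. *)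
Lemma strength_lt m lambda : type_strength (G_fun beta nu) m 1 lambda ->
  lambda < beta.
Proof.
move=> /type_strength_expansion[M [e [e0 M0 hM]]].
pose phi y : R := (cosh (beta * (m + y)) ^+ 2)^-1.
have phi_gt0 y : 0 < phi y by rewrite invr_gt0 exprn_gt0// cosh_gt0.
have phi_le1 y : phi y <= 1.
  by rewrite invf_le1 ?exprn_ege1 ?cosh_ge1// exprn_gt0// cosh_gt0.
have mphi : measurable_fun setT phi.
  have -> : phi = (fun y => expR (- 2 * lncosh (beta * (m + y)))).
    apply/funext => z; rewrite /phi mulNr expRN [2 * _]mulrC expRM_natr lnK//.
    by rewrite posrE cosh_gt0.
  apply: (measurableT_comp (f := @expR R)) => //; apply: measurable_funM => //.
  apply: (measurableT_comp (f := lncosh)); first exact: measurable_lncosh.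
  by apply: measurable_funM => //; exact: measurable_funD.
have iphi : nu.-integrable setT (EFin \o phi).
  apply: (bounded_integrable (M := 1) nu mphi) => y.
  by rewrite gtr0_norm.
have I0 := Rintegral_gt0 iphi phi_gt0.
set I := \int[nu]_x phi x in I0.
pose b2 := beta ^+ 2 / 4; have b20 : 0 < b2 by rewrite divr_gt0// exprn_gt0.
(* For [|t| <= 1] the quantity [w = b2 t^2 phi y] is at most [b2], so
   [ln (1 + w) >= w / (1 + b2) = K t^2 phi y]. *)
pose K := b2 / (1 + b2); have K0 : 0 < K by rewrite divr_gt0//; lra.
have curv t : 0 <= t <= 1 ->
    G_fun beta nu (m + t) + G_fun beta nu (m - t) - 2 * G_fun beta nu m
    <= (beta - K * I) * t ^+ 2.
  move=> t01; have Gt := G_fun_incr beta_gt0 nu_moment2 m t.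
  have GNt := G_fun_incr beta_gt0 nu_moment2 m (- t).
  suff : K * t ^+ 2 * I <= \int[nu]_y lncosh_incr beta m t y
      + \int[nu]_y lncosh_incr beta m (- t) y.
    move: (G_fun _ _ (m + t)) (G_fun _ _ (m - t)) (G_fun _ _ m) Gt GNt.
    move: (\int[nu]_y _) (\int[nu]_y _) => I1 I2 g1 g2 g3 e1 e2 hI.
    lra.
  move: t01 => {Gt GNt} /andP[t0 t1].
  rewrite -RintegralD//; [|exact: integrable_lncosh_incr..].
  rewrite -RintegralZl//; apply: le_Rintegral => //.
  - apply: (eq_integrable measurableT
      (fun y : R => (K * t ^+ 2)%:E * (phi y)%:E)%E) => //.
    exact: (integrableZl measurableT _ iphi).
  - apply: (eq_integrable measurableT ((EFin \o lncosh_incr beta m t) \+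
      (EFin \o lncosh_incr beta m (- t)))%E) => //.
    by apply: (integrableD measurableT); exact: integrable_lncosh_incr.
  move=> y _; have := lncosh_second_difference (beta * (m + y)) (beta * t).
  rewrite -mulrDr -mulrBr /lncosh_incr.
  have -> : m + y + t = m + t + y by ring.
  have -> : m + y - t = m - t + y by ring.
  set w := (beta * t) ^+ 2 / 4 / _ => hw.
  have wE : w = b2 * t ^+ 2 * phi y.
    by rewrite /w /b2 /phi; field; rewrite gt_eqF// cosh_gt0.
  have t2 : t ^+ 2 <= 1 by rewrite exprn_ile1.
  have p0 := phi_gt0 y; have p1 := phi_le1 y.
  have t20 := sqr_ge0 t.
  have w_ge0 : 0 <= w by rewrite wE !mulr_ge0// ltW.
  have w_le : w <= b2.
    by rewrite wE -mulrA ler_piMr ?(ltW b20)// mulr_ile1// ltW.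
  suff : K * t ^+ 2 * phi y <= ln (1 + w) by lra.
  apply: le_trans (ln_ge_frac w_ge0).
  have -> : K * t ^+ 2 * phi y = w / (1 + b2) by rewrite wE /K; field; lra.
  by rewrite ler_wpM2l// lef_pV2 ?posrE; lra.
(* Small enough for the expansion, for [curv], and for the remainder [2 M t] to stay below
   [K I / 2]; then [lambda <= beta - K I / 2]. *)
pose t := Num.min e (Num.min 1 (K * I / (4 * (M + 1)))).
have KI0 : 0 < K * I by rewrite mulr_gt0.
have M40 : 0 < 4 * (M + 1) by lra.
have t0 : 0 < t by rewrite !lt_min e0 ltr01 divr_gt0.
have te : t <= e by rewrite ge_min lexx.
have t1 : t <= 1 by rewrite !ge_min lexx orbT.
have tK : 4 * (M + 1) * t <= K * I.
  by rewrite mulrC -ler_pdivlMr// !ge_min lexx !orbT.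
have tabs : `|t| = t by rewrite gtr0_norm.
have := hM t; rewrite tabs te => /(_ isT); rewrite ler_norml => /andP[h1 _].
have := hM (- t); rewrite normrN tabs te => /(_ isT).
rewrite ler_norml => /andP[h2 _].
have /curv h3 : 0 <= t <= 1 by rewrite (ltW t0).
move: h1 h2; rewrite mulSn mul1n sqrrN => h1 h2.
have {h1 h2 h3} : lambda * t ^+ 2 - 2 * M * t ^+ 3 <= (beta - K * I) * t ^+ 2.
  have f2 : (1 + 1)`! = 2%N by [].
  move: (G_fun _ _ (m + t)) (G_fun _ _ (m - t)) (G_fun _ _ m) h1 h2 h3.
  by rewrite f2 => g1 g2 g3 h1 h2 h3; lra.
have -> : lambda * t ^+ 2 - 2 * M * t ^+ 3 = (lambda - 2 * M * t) * t ^+ 2 by ring.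
rewrite ler_pM2r ?exprn_gt0// => h.
have Mt0 : 0 <= M * t by rewrite mulr_ge0// ltW.
by clear -h Mt0 tK KI0 t0; lra.
Qed.

End G_properties.

(** * Bounds for a fixed realization of the field *)

Section quenched.
Context {R : realType} (beta : R) (beta_gt0 : 0 < beta) (nu : probability R R).
Context (nu_moment2 : (\int[nu]_x (x ^+ 2)%:E < +oo)%E).
Context (m : R) (nu_pure : pure_centered beta nu m).
Context (k : nat) (lambda : R)
  (m_type : type_strength (G_fun beta nu) m k lambda).
Context (alpha : R)
  (alpha_range : 1 - 1 / (2 * (2 * k%:R - 1)) < alpha < 1).
Context (h : nat -> R) (L : R) (L_ge : `|m| + 1 <= L).
Local Notation Gn n := (empirical_G beta h n).
Context (conc : \forall n \near \oo, forall t, `|t| <= L ->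
    `|(Gn n (m + t) - Gn n m) - (G_fun beta nu (m + t) - G_fun beta nu m)|
    <= 22 * beta * (`|t| * fluctuation n + n%:R^-1)).

Local Notation a := (@speed R k alpha).
Local Notation r := (@radius R alpha).

Let k_gt0 : (1 <= k)%N. Proof. by case: m_type. Qed.
Let lambda_gt0 : 0 < lambda. Proof. by case: m_type. Qed.

Let c : R := lambda / ((2 * k)`!)%:R.

Let c_gt0 : 0 < c. Proof. by rewrite divr_gt0// ltr0n fact_gt0. Qed.

Let even_ge0 (y : R) : 0 <= y ^+ (2 * k).
Proof. by rewrite mulnC exprM sqr_ge0. Qed.

Let abs_even (y : R) : `|y| ^+ (2 * k) = y ^+ (2 * k).
Proof. by rewrite -normrX ger0_norm. Qed.

Let abs_le_even (y : R) : `|y| <= 1 + y ^+ (2 * k).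
Proof.
have [y1|y1] := leP `|y| 1; first by rewrite (le_trans y1)// lerDl.
rewrite -abs_even (@le_trans _ _ (`|y| ^+ (2 * k)))//; last by lra.
by rewrite -[leLHS]expr1 ler_eXn2l// muln_gt0.
Qed.

(** On the scale [r n] the Taylor term of G becomes [a n * (c * y ^+ (2 * k))]. The random error and
    the Taylor remainder are small multiples of the speed, uniformly even for [y] of order
    [1 / r n]. *)
Lemma near_incr_scaled e : 0 < e -> exists2 e0, 0 < e0 &
  \forall n \near \oo, forall y, `|y| * r n <= e0 ->
    `|n%:R * (Gn n (m + y * r n) - Gn n m) - a n * (c * y ^+ (2 * k))|
      <= e * a n * (1 + y ^+ (2 * k)).
Proof.
move=> e_gt0; have [M [d0 [d0_gt0 M0 hM]]] := type_strength_expansion m_type.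
have L0 : 0 < L by have := normr_ge0 m; have := L_ge; lra.
have M10 : 0 < 2 * (M + 1) by lra.
(* Inside the range of the expansion, inside that of the concentration bound, and with
   [M * e0 <= e / 2]. *)
pose e0 := Num.min d0 (Num.min L (e / (2 * (M + 1)))).
have e0_gt0 : 0 < e0 by rewrite !lt_min d0_gt0 L0 divr_gt0.
have e0d : e0 <= d0 by rewrite ge_min lexx.
have e0L : e0 <= L by rewrite !ge_min lexx orbT.
have e0e : M * e0 <= e / 2.
  have : e0 * (2 * (M + 1)) <= e by rewrite -ler_pdivlMr// !ge_min lexx !orbT.
  by move: e0_gt0; nra.
have b22 : 0 < 22 * beta by rewrite mulr_gt0.
exists e0 => //; near=> n => y ye.
have n0 : (0 < n)%N by near: n; exists 1%N.
have n0' : 0 < n%:R :> R by rewrite ltr0n.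
have r0 : 0 < r n := radius_gt0 alpha n0.
have a0 : 0 < a n := speed_gt0 k alpha n0.
have aE : a n = n%:R * r n ^+ (2 * k) := speedE k alpha n0.
have hfl : n%:R * (r n * fluctuation n) <= e / 4 / (22 * beta) * a n.
  near: n; apply: (near_fluctuation_le k_gt0 alpha_range).
  by rewrite !divr_gt0.
have ha : 22 * beta / (e / 4) <= a n.
  by near: n; exact: (near_speed_ge k_gt0 alpha_range).
have hconc : forall t, `|t| <= L ->
    `|(Gn n (m + t) - Gn n m) - (G_fun beta nu (m + t) - G_fun beta nu m)|
    <= 22 * beta * (`|t| * fluctuation n + n%:R^-1) by near: n.
set t := y * r n; have tabs : `|t| = `|y| * r n by rewrite normrM (gtr0_norm r0).
have te : `|t| <= e0 by rewrite tabs.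
have {hconc} h1 := hconc t (le_trans te e0L).
have {hM} h2 := hM t (le_trans te e0d).
set X := Gn n _ - _ in h1 *; set Y := G_fun _ _ _ - _ in h1 h2.
have -> : n%:R * X - a n * (c * y ^+ (2 * k)) =
    n%:R * (X - Y) + n%:R * (Y - c * t ^+ (2 * k)).
  by rewrite aE /t exprMn; ring.
rewrite (le_trans (ler_normD _ _))// !normrM (gtr0_norm n0').
have h1' : n%:R * `|X - Y| <= e / 4 * a n * `|y| + e / 4 * a n.
  apply: le_trans (ler_wpM2l (ltW n0') h1) _.
  have -> : n%:R * (22 * beta * (`|t| * fluctuation n + n%:R^-1)) =
     22 * beta * (n%:R * (r n * fluctuation n)) * `|y| + 22 * beta.
    by rewrite tabs; field; rewrite gt_eqF.
  apply: lerD.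
    apply: ler_wpM2r => //; apply: le_trans (ler_wpM2l (ltW b22) hfl) _.
    by rewrite mulrA [_ * (_ / _)]mulrC divfK// gt_eqF.
  by rewrite [leRHS]mulrC -ler_pdivrMr ?divr_gt0.
have h2' : n%:R * `|Y - c * t ^+ (2 * k)| <= e / 2 * a n * y ^+ (2 * k).
  apply: le_trans (ler_wpM2l (ltW n0') h2) _.
  have -> : n%:R * (M * `|t| ^+ (2 * k).+1) = M * `|t| * (a n * y ^+ (2 * k)).
    by rewrite exprSr abs_even aE /t exprMn; ring.
  rewrite -[leRHS]mulrA ler_wpM2r ?mulr_ge0 ?(ltW a0)//.
  by rewrite (le_trans _ e0e)// ler_wpM2l.
have := abs_le_even y; have := even_ge0 y; move=> Z0 yZ.
have ea : 0 < e * a n by rewrite mulr_gt0.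
have h3 := ler_wpM2l (ltW ea) yZ.
have h4 : 0 <= e * a n * y ^+ (2 * k) by rewrite mulr_ge0// ltW.
move: h1' h2' h3 h4 ea; move: (y ^+ (2 * k)) (a n) `|y| (n%:R * `|X - Y|).
by move=> Z A B C; lra.
Unshelve. all: by end_near. Qed.

(** At fixed distance from [m] the gap of G survives, halved, because the concentration error
    vanishes uniformly for [|t| <= L]. *)
Lemma near_incr_gap e : 0 < e -> exists2 g, 0 < g &
  \forall n \near \oo, forall t, e <= `|t| <= L -> g <= Gn n (m + t) - Gn n m.
Proof.
move=> e_gt0.
have [g g0 hg] := G_fun_gap beta_gt0 nu_moment2 L nu_pure e_gt0.
have L0 : 0 < L by have := normr_ge0 m; have := L_ge; lra.
exists (g / 2); first by rewrite divr_gt0.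
near=> n => t /andP[et tL].
have n0 : (0 < n)%N by near: n; exists 1%N.
have n0' : 0 < n%:R :> R by rewrite ltr0n.
have hconc : forall t, `|t| <= L ->
    `|(Gn n (m + t) - Gn n m) - (G_fun beta nu (m + t) - G_fun beta nu m)|
    <= 22 * beta * (`|t| * fluctuation n + n%:R^-1) by near: n.
have := hconc t tL; have := hg t; rewrite et tL => /(_ isT).
rewrite ler_norml => h1 /andP[h2 _].
have fl0 : 0 <= fluctuation n :> R := sqrtr_ge0 _.
have hfl : fluctuation n <= g / 4 / (22 * beta) / L.
  by near: n; apply: near_fluctuation_small; rewrite !divr_gt0// mulr_gt0.
have hn : (g / 4 / (22 * beta))^-1 <= n%:R by near: n; exact: nbhs_infty_ger.
have b22 : 0 < 22 * beta by rewrite mulr_gt0.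
have hnV : n%:R^-1 <= g / 4 / (22 * beta).
  by rewrite -[leRHS]invrK lef_pV2 ?posrE ?invr_gt0// !divr_gt0.
have h3 : `|t| * fluctuation n <= g / 4 / (22 * beta).
  rewrite (le_trans (ler_wpM2r fl0 tL))// mulrC.
  by rewrite -ler_pdivlMr.
have : 22 * beta * (`|t| * fluctuation n + n%:R^-1) <= g / 2.
  rewrite mulrC -ler_pdivlMr//.
  have -> : g / 2 / (22 * beta) = g / 4 / (22 * beta) + g / 4 / (22 * beta).
    by field; rewrite gt_eqF.
  exact: lerD.
move: h1 h2; set X := _ - empirical_G _ _ _ _; set Y := _ - G_fun _ _ _.
by move: (_ * (_ + _)) X Y => Z X Y; lra.
Unshelve. all: by end_near. Qed.

(* A magnetization m + v r_n is best described by the tilt m + kappa v r_n. For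
   k = 1 the two exponents lambda y^2 / 2 and beta (v - y)^2 / 2 live on the same
   scale and y = kappa v maximizes their difference; for k >= 2 the second one
   dominates and forces y = v. *)
Let kappa : R := if k == 1%N then beta / (beta - lambda) else 1.

Let C : R :=
  if k == 1%N then (2 * (lambda^-1 - beta^-1))^-1 else lambda / ((2 * k)`!)%:R.

Let lambda_lt : k = 1%N -> lambda < beta.
Proof.
move=> k1; apply: (strength_lt beta_gt0 nu_moment2 (m := m)).
by have := m_type; rewrite k1.
Qed.

Let kappa_gt0 : 0 < kappa.
Proof.
by rewrite /kappa; case: eqP => // /lambda_lt ?; rewrite divr_gt0// subr_gt0.
Qed.

Let C_gt0 : 0 < C.
Proof.
rewrite /C; case: eqP => // /lambda_lt lb; rewrite invr_gt0 mulr_gt0// subr_gt0.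
by rewrite ltf_pV2.
Qed.

(** For [k = 1], [lambda kappa^2 - beta (kappa - 1)^2 = lambda beta / (beta - lambda)], which is the
    inverse of [lambda^-1 - beta^-1]; for [k >= 2] the square vanishes. *)
Let rate_split n y : (0 < n)%N ->
  a n * (C * y ^+ (2 * k)) = a n * (c * (kappa * y) ^+ (2 * k))
    - n%:R * (beta / 2) * ((kappa - 1) * y * r n) ^+ 2.
Proof.
move=> n0; rewrite /C /kappa; case: eqP => [k1|_]; last first.
  by rewrite subrr !mul0r expr0n mulr0 subr0 mul1r.
have lb := lambda_lt k1.
rewrite /c (speedE k alpha n0) k1 muln1 (_ : 2`! = 2%N)//.
by field; rewrite !gt_eqF ?subr_gt0.
Qed.

Let rateE x : rate beta lambda k x = C * x ^+ (2 * k).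
Proof.
rewrite /rate /C; case: eqP => [->|_]; first by rewrite muln1 mulrC.
by rewrite mulrAC.
Qed.

(** * Upper bound for the weight of an event *)

Let Z0 n : R := 2 ^+ n * expR (- (n%:R * Gn n m)).

Let Z0_ge0 n : 0 <= Z0 n.
Proof. by rewrite mulr_ge0 ?exprn_ge0 ?expR_ge0. Qed.

Lemma near_sum_weight_le rho e : 0 <= rho -> 0 < e ->
  \forall n \near \oo, forall A : pred (n.-tuple bool),
    (forall s, A s -> rho <= rate beta lambda k ((magnetization s - m) / r n)) ->
    \sum_(s | A s) gibbs_weight beta h s <= Z0 n * expR (- (a n * (rho - e))).
Proof.
move=> rho0 e0.
pose theta := kappa ^+ (2 * k) / C.
have theta0 : 0 < theta by rewrite divr_gt0 ?exprn_gt0.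
(* Since [e1 * theta <= 1], the expression [X - e1 (1 + theta X)] is nondecreasing in the rate [X],
   so its worst case is [X = rho], where the loss is at most [e / 2]. *)
pose e1 := Num.min theta^-1 (e / 2 / (1 + theta * rho)).
have tr0 : 0 < 1 + theta * rho by rewrite ltr_pwDl// mulr_ge0// ltW.
have e1_gt0 : 0 < e1 by rewrite lt_min invr_gt0 theta0 !divr_gt0.
have e1t : e1 * theta <= 1.
  by rewrite -ler_pdivlMr// div1r ge_min lexx.
have e1r : e1 * (1 + theta * rho) <= e / 2.
  by rewrite -ler_pdivlMr// ge_min lexx orbT.
have [e2 e2_gt0 hU] := near_incr_scaled e1_gt0.
have e3_gt0 : 0 < e2 / kappa by rewrite divr_gt0.
have [g g0 hV] := near_incr_gap e3_gt0.
near=> n => A hA.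
have n0 : (0 < n)%N by near: n; exists 1%N.
have n0' : 0 < n%:R :> R by rewrite ltr0n.
have r0 : 0 < r n := radius_gt0 alpha n0.
have a0 : 0 < a n := speed_gt0 k alpha n0.
have aE : a n = n%:R * r n ^+ (2 * k) := speedE k alpha n0.
have hUn : forall y, `|y| * r n <= e2 ->
    `|n%:R * (Gn n (m + y * r n) - Gn n m) - a n * (c * y ^+ (2 * k))|
      <= e1 * a n * (1 + y ^+ (2 * k)) by near: n.
have hVn : forall t, e2 / kappa <= `|t| <= L -> g <= Gn n (m + t) - Gn n m.
  by near: n.
have r1 : r n <= 1 by near: n; apply: (near_radius_le alpha_range).
(* Far from [m] this yields [n g >= n r (rho + 1) >= a n * (rho + 1)]. *)
have rg : r n <= g / (rho + 1).
  by near: n; apply: (near_radius_le alpha_range); rewrite divr_gt0// ltr_wpDl.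
(* The second half of [e] absorbs the number [n + 1] of magnetizations. *)
have hln : ln n.+1%:R <= e / 2 * a n.
  by near: n; apply: (near_lnS_speed k_gt0 alpha_range); rewrite divr_gt0.
(* Near [m] the optimal tilt is used; farther away [tau u = u] cancels the square and the gap alone
   suffices. *)
pose tau u := if kappa * `|u - m| <= e2 then m + kappa * (u - m) else u.
apply: le_trans
  (@sum_gibbs_weight_le _ beta h n n0 A tau m (a n * (rho - e / 2)) _) _.
  move=> s /hA; rewrite rateE; set u := magnetization s.
  have [y uE] : exists y, u = m + y * r n.
    by exists ((u - m) / r n); rewrite divfK ?gt_eqF// subrKC.
  rewrite /tau uE [m + _ - m]addrC addKr mulfK ?gt_eqF// normrM (gtr0_norm r0).
  case: ifPn => [small|]; last first.
    rewrite -ltNge subrr expr0n mulr0 subr0 => big rhoy.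
    have : g <= Gn n (m + y * r n) - Gn n m.
      apply: hVn; rewrite ler_pdivrMr// normrM (gtr0_norm r0) mulrC ltW//=.
      have -> : `|y| * r n = `|u - m|.
        by rewrite uE [m + _ - m]addrC addKr normrM (gtr0_norm r0).
      apply: le_trans L_ge; rewrite (le_trans (ler_normB _ _))// addrC lerD2l.
      exact: abs_magnetization_le1.
    move=> /(ler_wpM2l (ltW n0')); apply: le_trans.
    rewrite aE -mulrA ler_pM2l//.
    apply: (@le_trans _ _ (r n * (rho + 1))); last first.
      by rewrite -ler_pdivlMr ?ltr_wpDl.
    apply: (@le_trans _ _ (r n ^+ (2 * k) * (rho + 1))).
      by rewrite ler_pM2l ?exprn_gt0//; lra.
    rewrite ler_pM2r ?ltr_wpDl// -[leRHS]expr1 ler_wiXn2l ?(ltW r0)//.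
    by rewrite muln_gt0.
  set X := C * y ^+ (2 * k) => rhoX.
  rewrite mulrA in small.
  have := hUn (kappa * y); rewrite normrM (gtr0_norm kappa_gt0) small.
  move=> /(_ isT); rewrite ler_norml => /andP[hlow _].
  have rs := rate_split y n0; rewrite -/X in rs.
  have -> : m + y * r n - (m + kappa * (y * r n)) = - ((kappa - 1) * y * r n).
    by ring.
  rewrite sqrrN.
  have ky : (kappa * y) ^+ (2 * k) = theta * X.
    by rewrite exprMn /theta /X mulrA divfK// gt_eqF.
  rewrite ky in hlow rs.
  have -> : m + kappa * (y * r n) = m + kappa * y * r n by rewrite mulrA.
  set D := n%:R * (_ - _) in hlow *; set Q := n%:R * (beta / 2) * _ in rs *.
  have : a n * (rho - e / 2) <= a n * (X - e1 * (1 + theta * X)).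
    rewrite ler_pM2l//.
    have : (1 - e1 * theta) * rho <= (1 - e1 * theta) * X.
      by rewrite ler_wpM2l// subr_ge0.
    by move: e1r; lra.
  move: D Q (a n) hlow rs => D Q A0 hlow rs; lra.
rewrite -/(Z0 n) ler_wpM2l ?Z0_ge0//.
have -> : n.+1%:R = expR (ln n.+1%:R) :> R by rewrite lnK// posrE ltr0n.
rewrite -expRD ler_expR.
move: (ln _) (a n) hln => l A0 hln; lra.
Unshelve. all: by end_near. Qed.

(** * Concentration under the tilt and lower bound for windows *)

Let kappa_scale n : (0 < n)%N ->
  n%:R * r n ^+ 2 * `|kappa - 1| = a n * `|kappa - 1|.
Proof.
move=> n0; rewrite /kappa; case: eqP => [k1|_]; last first.
  by rewrite subrr normr0 !mulr0.
by rewrite (speedE k alpha n0) k1.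
Qed.

(** The leading exponent of [tilted_tail]. For [k = 1] the terms linear in [t] cancel by the choice
    of [kappa]; for [k >= 2] the term [n r^2 beta t^2 / 2] dominates. *)
Let near_tilt_gap v t : t != 0 -> \forall n \near \oo,
  a n * (c * (kappa * v) ^+ (2 * k)) - a n * (c * (kappa * v + t) ^+ (2 * k))
    - n%:R * r n ^+ 2 * (beta * (t * (v - kappa * v) + t ^+ 2 / 2))
  <= - (a n * (beta * t ^+ 2 / 2)).
Proof.
move=> t_neq0; have t2 : 0 < t ^+ 2 by rewrite exprn_even_gt0.
have b0 := beta_gt0.
rewrite /kappa; case: eqP => [k1|k_neq1].
  near=> n.
  have n0 : (0 < n)%N by near: n; exists 1%N.
  have a0 : 0 < a n := speed_gt0 k alpha n0.
  have lb := lambda_lt k1.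
  have -> : n%:R * r n ^+ 2 = a n by rewrite (speedE k alpha n0) k1.
  move: (a n) a0 => A a0; rewrite /c k1 muln1 (_ : 2`! = 2%N)//.
  rewrite -subr_ge0 (_ : _ - _ = A * (lambda * t ^+ 2 / 2)).
    by rewrite mulr_ge0 ?(ltW a0)// divr_ge0// mulr_ge0 ?(ltW lambda_gt0)// ltW.
  by field; rewrite gt_eqF ?subr_gt0.
have k2 : (2 <= k)%N by rewrite ltn_neqAle k_gt0 andbT eq_sym; exact/eqP.
pose M : R := 1 + 2 * c * v ^+ (2 * k) / (beta * t ^+ 2).
near=> n.
have n0 : (0 < n)%N by near: n; exists 1%N.
have a0 : 0 < a n := speed_gt0 k alpha n0.
have hM : M * a n <= n%:R * r n ^+ 2.
  by near: n; exact: (near_radius2_ge alpha_range M k2).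
rewrite mul1r subrr mulr0 add0r.
have bt : 0 < beta * t ^+ 2 / 2 by rewrite divr_gt0// mulr_gt0.
have h1 : M * a n * (beta * (t ^+ 2 / 2)) <=
    n%:R * r n ^+ 2 * (beta * (t ^+ 2 / 2)).
  by rewrite ler_wpM2r// mulrA ltW.
have h2 : 0 <= a n * (c * (v + t) ^+ (2 * k)).
  by rewrite mulr_ge0 ?(ltW a0)// mulr_ge0 ?(ltW c_gt0).
have -> : - (a n * (beta * t ^+ 2 / 2)) =
    a n * (c * v ^+ (2 * k)) - M * a n * (beta * (t ^+ 2 / 2)).
  by rewrite /M; field; rewrite (gt_eqF b0) t_neq0.
move: (a n * _) (a n * _) (_ * _ * _) (_ * (beta * _)) h1 h2 => A B D E h1 h2; lra.
Unshelve. all: by end_near. Qed.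

(** The sign of [t] selects the tail. Two tails of mass at most [1/4] leave mass [1/2] in the window
    around [v]. *)
Let near_tilted_tail_le v t : t != 0 -> \forall n \near \oo,
  \sum_(s : n.-tuple bool | t ^+ 2 <= t * ((magnetization s - m) / r n - v))
    tilted_pmf beta h (m + kappa * v * r n) s <= 1 / 4.
Proof.
move=> t_neq0; have t2 : 0 < t ^+ 2 by rewrite exprn_even_gt0.
have b0 := beta_gt0.
set y := kappa * v.
(* Normalizes the approximation errors at [y] and [y + t] to a total of [a n * (beta t^2 / 4)], half
   of the available exponent. *)
pose S := 2 + y ^+ (2 * k) + (y + t) ^+ (2 * k).
have S0 : 0 < S by rewrite /S -addrA ltr_wpDr// addr_ge0.
have bt : 0 < beta * t ^+ 2 / 4 by rewrite divr_gt0// mulr_gt0.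
have e1_gt0 : 0 < beta * t ^+ 2 / 4 / S by rewrite divr_gt0.
have [e2 e2_gt0 hU] := near_incr_scaled e1_gt0.
near=> n.
have n0 : (0 < n)%N by near: n; exists 1%N.
have n0' : 0 < n%:R :> R by rewrite ltr0n.
have r0 : 0 < r n := radius_gt0 alpha n0.
have a0 : 0 < a n := speed_gt0 k alpha n0.
have hUn : forall y, `|y| * r n <= e2 ->
    `|n%:R * (Gn n (m + y * r n) - Gn n m) - a n * (c * y ^+ (2 * k))|
      <= beta * t ^+ 2 / 4 / S * a n * (1 + y ^+ (2 * k)) by near: n.
have rsmall z : r n <= e2 / (1 + `|z|) -> `|z| * r n <= e2.
  have z0 := normr_ge0 z; rewrite ler_pdivlMr ?ltr_pwDl//.
  by apply: le_trans; rewrite mulrC ler_wpM2l ?(ltW r0)// lerDr.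
have hy : `|y| * r n <= e2.
  apply: rsmall; near: n; apply: (near_radius_le alpha_range).
  by rewrite divr_gt0// ltr_pwDl.
have hyt : `|y + t| * r n <= e2.
  apply: rsmall; near: n; apply: (near_radius_le alpha_range).
  by rewrite divr_gt0// ltr_pwDl.
have := hUn y hy; rewrite ler_norml => /andP[_ U1].
have := hUn (y + t) hyt; rewrite ler_norml => /andP[U2 _].
have gap : a n * (c * y ^+ (2 * k)) - a n * (c * (y + t) ^+ (2 * k))
    - n%:R * r n ^+ 2 * (beta * (t * (v - y) + t ^+ 2 / 2))
  <= - (a n * (beta * t ^+ 2 / 2)).
  by near: n; exact: near_tilt_gap.
have ha : 3 / (beta * t ^+ 2 / 4) <= a n.
  by near: n; exact: (near_speed_ge k_gt0 alpha_range).
rewrite (eq_bigl (fun s => r n ^+ 2 * (t * (v - y) + t ^+ 2) <=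
    t * r n * (magnetization s - (m + y * r n)))); last first.
  move=> s /=; set w := (magnetization s - m) / r n.
  have -> : magnetization s - (m + y * r n) = (w - y) * r n.
    by rewrite /w; field; rewrite gt_eqF.
  have -> : t * r n * ((w - y) * r n) =
    r n ^+ 2 * (t * (v - y) + t * (w - v)) by ring.
  by rewrite [RHS]ler_pM2l ?exprn_gt0// lerD2l.
apply: (le_trans (tilted_tail beta_gt0 h n0 _ _ _)).
apply: (@le_trans _ _ (expR (- 3))); last first.
  rewrite expRN div1r lef_pV2 ?posrE ?expR_gt0//.
  by have := expR_ge1Dx (3 : R); lra.
rewrite ler_expR.
have ha' : 3 <= a n * (beta * t ^+ 2 / 4) by rewrite -ler_pdivrMr.
rewrite [leLHS](_ : _ = n%:R * (Gn n (m + y * r n) - Gn n m)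
   - n%:R * (Gn n (m + (y + t) * r n) - Gn n m)
   - n%:R * r n ^+ 2 * (beta * (t * (v - y) + t ^+ 2 / 2))); last first.
  by rewrite [(y + t) * _]mulrDl addrA; field.
have hS : beta * t ^+ 2 / 4 / S * a n * (1 + y ^+ (2 * k)) +
    beta * t ^+ 2 / 4 / S * a n * (1 + (y + t) ^+ (2 * k)) =
    a n * (beta * t ^+ 2 / 4).
  by rewrite -mulrDr (_ : _ + _ = S) 1?mulrAC ?divfK ?gt_eqF// /S; ring.
have hH : a n * (beta * t ^+ 2 / 2) = 2 * (a n * (beta * t ^+ 2 / 4)) by field.
rewrite hH in gap.
move: U1 U2 gap ha' hS.
set D1 := n%:R * _; set D2 := n%:R * (_ - _).
set E1 := _ / S * _ * _; set E2 := _ / S * _ * _.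
set F1 := a n * (c * _); set F2 := a n * (c * _).
set Q := n%:R * _ * _; set T := a n * _.
by move: D1 D2 E1 E2 F1 F2 Q T => D1 D2 E1 E2 F1 F2 Q T; lra.
Unshelve. all: by end_near. Qed.

Lemma near_window_weight_ge v eta e : 0 < eta -> 0 < e ->
  \forall n \near \oo,
    Z0 n * expR (- (a n * (rate beta lambda k v + e))) <=
    \sum_(s : n.-tuple bool | `|(magnetization s - m) / r n - v| < eta)
      gibbs_weight beta h s.
Proof.
move=> eta0 e0; have b0 := beta_gt0; rewrite rateE.
set y := kappa * v; pose B := beta * `|kappa - 1| * `|v|.
have B0 : 0 <= B by rewrite mulr_ge0// mulr_ge0// ltW.
(* The window is shrunk so that the cross term between [dev s] and [v - y] costs at most
   [a n * (e / 3)]. *)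
pose eta' := Num.min eta (e / 3 / (B + 1)).
have eta'0 : 0 < eta' by rewrite lt_min eta0 !divr_gt0// ltr_wpDl.
have eta'_le : eta' <= eta by rewrite ge_min lexx.
have eta'B : eta' * B <= e / 3.
  have : eta' * (B + 1) <= e / 3.
    by rewrite -ler_pdivlMr ?ltr_wpDl// ge_min lexx orbT.
  by move: eta'0 => ?; lra.
have yk0 : 0 < 1 + y ^+ (2 * k) by rewrite ltr_pwDl.
have e1_gt0 : 0 < e / 3 / (1 + y ^+ (2 * k)) by rewrite !divr_gt0.
have [e2 e2_gt0 hU] := near_incr_scaled e1_gt0.
near=> n.
have n0 : (0 < n)%N by near: n; exists 1%N.
have n0' : 0 < n%:R :> R by rewrite ltr0n.
have r0 : 0 < r n := radius_gt0 alpha n0.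
have a0 : 0 < a n := speed_gt0 k alpha n0.
have hUn : forall z, `|z| * r n <= e2 ->
    `|n%:R * (Gn n (m + z * r n) - Gn n m) - a n * (c * z ^+ (2 * k))|
      <= e / 3 / (1 + y ^+ (2 * k)) * a n * (1 + z ^+ (2 * k)) by near: n.
have hy : `|y| * r n <= e2.
  have : r n <= e2 / (1 + `|y|).
    by near: n; apply: (near_radius_le alpha_range); rewrite divr_gt0// ltr_pwDl.
  rewrite ler_pdivlMr ?ltr_pwDl//.
  by apply: le_trans; rewrite mulrC ler_wpM2l ?(ltW r0)// lerDr.
have tailR : \sum_(s : n.-tuple bool | eta' ^+ 2 <= eta' *
    ((magnetization s - m) / r n - v)) tilted_pmf beta h (m + y * r n) s <= 1 / 4.
  by near: n; apply: near_tilted_tail_le; rewrite gt_eqF.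
have tailL : \sum_(s : n.-tuple bool | (- eta') ^+ 2 <= - eta' *
    ((magnetization s - m) / r n - v)) tilted_pmf beta h (m + y * r n) s <= 1 / 4.
  by near: n; apply: near_tilted_tail_le; rewrite oppr_eq0 gt_eqF.
have ha : 3 / e <= a n.
  by near: n; exact: (near_speed_ge k_gt0 alpha_range).
pose dev (s : n.-tuple bool) := (magnetization s - m) / r n - v.
have mass : 1 / 2 <= \sum_(s : n.-tuple bool | `|dev s| < eta')
    tilted_pmf beta h (m + y * r n) s.
  have := sum_tilted_pmf beta h n (m + y * r n).
  rewrite (bigID (fun s => `|dev s| < eta'))/=.
  suff : \sum_(s | ~~ (`|dev s| < eta')) tilted_pmf beta h (m + y * r n) s <= 1 / 2.
    by move: (\sum_(s | _) _) (\sum_(s | _) _) => A D; lra.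
  have -> : 1 / 2 = 1 / 4 + 1 / 4 :> R by field.
  apply: le_trans (lerD tailR tailL).
  rewrite [leLHS]big_mkcond [X in _ <= X + _]big_mkcond.
  rewrite [X in _ <= _ + X]big_mkcond/=.
  rewrite -big_split/=; apply: ler_sum => s _; rewrite -/(dev s) -leNgt.
  have p0 := tilted_pmf_ge0 beta h (m + y * r n) s.
  rewrite sqrrN expr2 !mulNr -mulrN !ler_pM2l//.
  case: ifPn => [|_]; last by rewrite addr_ge0//; case: ifP.
  by rewrite ler_normr => /orP[->|->]; [rewrite lerDl|rewrite lerDr]; case: ifP.
apply: (@le_trans _ _ (\sum_(s : n.-tuple bool | `|dev s| < eta')
    gibbs_weight beta h s)); last first.
  rewrite [leLHS]big_mkcond [leRHS]big_mkcond/=; apply: ler_sum => s _.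
  case: ifPn => [h1|_]; first by rewrite ifT// (lt_le_trans h1).
  by case: ifP => // _; exact: expR_ge0.
have ha1 : 1 <= a n * (e / 3).
  by rewrite mulrA ler_pdivlMr// mul1r -ler_pdivrMr.
have U : n%:R * (Gn n (m + y * r n) - Gn n m) - a n * (c * y ^+ (2 * k))
    <= a n * (e / 3).
  apply: le_trans (ler_norm _) _; apply: le_trans (hUn y hy) _.
  by rewrite mulrAC divfK ?gt_eqF// mulrC.
have rs := rate_split v n0; rewrite -/y in rs.
set E := a n * (_ + e).
(* The factor [expR 1 >= 2] compensates the mass [1/2]; its exponent 1 uses another third of [e],
   and the approximation of [Gn] the last one. *)
apply: (@le_trans _ _ (\sum_(s : n.-tuple bool | `|dev s| < eta')
    Z0 n * expR (1 - E) * tilted_pmf beta h (m + y * r n) s)).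
  rewrite -mulr_sumr -[leRHS]mulrA ler_wpM2l ?Z0_ge0//.
  rewrite expRD mulrAC -[leLHS]mul1r ler_wpM2r ?expR_ge0//.
  have e2' : 2 <= expR 1 :> R by have := expR_ge1Dx (1 : R); lra.
  rewrite [leLHS](_ : _ = 2 * (1 / 2)); last by field.
  by rewrite ler_pM.
apply: ler_sum => s hs.
rewrite (gibbs_weight_tilt beta h n0 (m + y * r n)) ler_wpM2r ?tilted_pmf_ge0//.
rewrite /Z0 -[leLHS]mulrA -[leRHS]mulrA ler_wpM2l ?exprn_ge0//.
rewrite -[leLHS]expRD -[leRHS]expRD ler_expR.
have -> : magnetization s - (m + y * r n) = (dev s + (v - y)) * r n.
  by rewrite /dev; field; rewrite gt_eqF.
have vy : v - y = - ((kappa - 1) * v) by rewrite /y; ring.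
have hdev : - (a n * (e / 3)) <= n%:R * r n ^+ 2 * (beta * (dev s * (v - y))).
  have hd : `|dev s * (v - y)| <= eta' * (`|kappa - 1| * `|v|).
    by rewrite vy normrM normrN normrM ler_wpM2r// ltW.
  have nrb : 0 <= n%:R * r n ^+ 2 * beta.
    by rewrite mulr_ge0 ?(ltW b0)// mulr_ge0 ?sqr_ge0.
  have := ler_wpM2l nrb hd.
  have -> : n%:R * r n ^+ 2 * beta * (eta' * (`|kappa - 1| * `|v|)) =
      a n * (eta' * B).
    rewrite [LHS](_ : _ = n%:R * r n ^+ 2 * `|kappa - 1| * (eta' * (beta * `|v|))).
      by rewrite kappa_scale// /B; ring.
    by ring.
  have := ler_wpM2l (ltW a0) eta'B.
  have := ler_wpM2l nrb (ler_norm (- (dev s * (v - y)))); rewrite normrN.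
  rewrite mulrA.
  move: (a n * (e / 3)) (a n * (eta' * B)) (n%:R * _ * _) (dev s * _) => A D F G.
  by move: `|G| => G'; lra.
have hsq : n%:R * r n ^+ 2 * (beta * (dev s * (v - y))) +
    n%:R * (beta / 2) * ((kappa - 1) * v * r n) ^+ 2 <=
    n%:R * (beta / 2) * ((dev s + (v - y)) * r n) ^+ 2.
  rewrite -subr_ge0 (_ : _ - _ = n%:R * (beta / 2) * (dev s * r n) ^+ 2).
    by rewrite mulr_ge0 ?sqr_ge0// mulr_ge0 ?divr_ge0// ltW.
  by rewrite vy; field.
have -> : E = a n * (C * v ^+ (2 * k)) + 3 * (a n * (e / 3)) by rewrite /E; field.
move: U rs hdev hsq ha1; rewrite mulrBr.
move: (n%:R * Gn n m) (n%:R * Gn n (m + y * r n)) => Am Ax.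
move: (n%:R * _ * (beta * _)) (_ * (beta / 2) * _) (_ * (beta / 2) * _).
move: (a n * (c * _)) (a n * (C * _)) (a n * (e / 3)) => H1 H2 H3 H4 H5 H6.
by move=> U rs hdev hsq ha1; lra.
Unshelve. all: by end_near. Qed.

(** * Goodness of the rate function *)

Lemma rate_ge0 x : 0 <= rate beta lambda k x.
Proof. by rewrite rateE mulr_ge0// ltW. Qed.

Let continuous_rate : continuous (rate beta lambda k).
Proof.
rewrite (funext rateE) => x.
by apply: cvgM; [exact: cvg_cst|exact: exprn_continuous].
Qed.

Lemma good_rate_function_rate :
  good_rate_function (fun x => (rate beta lambda k x)%:E).
Proof.
split.
  move=> x b; rewrite lte_fin => bx.
  exists [set y | b < rate beta lambda k y] => //.
  exact: (continuous_rate (lt_nbhsr bx)).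
move=> b; have ball_compact := @segment_compact R (- (1 + b / C)) (1 + b / C).
apply: (subclosed_compact _ ball_compact).
  have -> : [set x | ((rate beta lambda k x)%:E <= b%:E)%E] =
      rate beta lambda k @^-1` [set y | y <= b].
    by apply/seteqP; split => x /=; rewrite lee_fin.
  by apply: preimage_closed => [x _|]; [exact: continuous_rate|exact: closed_le].
move=> x /=; rewrite lee_fin rateE => xb; rewrite in_itv/= -ler_norml.
by rewrite (le_trans (abs_le_even x))// lerD2l ler_pdivlMr// mulrC.
Qed.

End quenched.

(** * The moderate deviations principle *)

Lemma gibbsE {R : realType} (beta : R) (h : nat -> R) n
    (A : set (n.-tuple bool)) :
  gibbs beta h n A =
  ((\sum_(s | s \in A) gibbs_weight beta h s) / partition_function beta h n)%:E.
Proof.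
rewrite /gibbs -{1}(set_mem_set A) -(bigfs _ (r := index_enum _))/=.
- by rewrite sumEFin mulr_suml.
- exact: index_enum_uniq.
- by move=> s _; rewrite mem_index_enum.
Qed.

Section limits.
Context {R : realType}.
Implicit Types (u : (\bar R)^nat) (l : \bar R).
Local Open Scope ereal_scope.

Lemma limn_esup_le u l : (\forall n \near \oo, u n <= l) -> limn_esup u <= l.
Proof.
move=> ul; apply: ge_ereal_inf; exists (ereal_sup (u @` [set n | u n <= l])).
  by exists [set n | u n <= l].
by apply: ge_ereal_sup => _ [n /= un <-].
Qed.

Lemma limn_einf_ge u l : (\forall n \near \oo, l <= u n) -> l <= limn_einf u.
Proof.
move=> lu; rewrite /limn_einf leeNr; apply: limn_esup_le.
by apply: filterS lu => n /=; rewrite leeN2.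
Qed.

End limits.

(** * From weight bounds to the deviation bounds *)

Section mdp.
Context {R : realType} (beta : R) (h : nat -> R) (m alpha : R) (a : nat -> R)
  (I : R -> R) (Z0 : nat -> R).
Hypotheses (a_gt0 : forall n, (0 < n)%N -> 0 < a n)
  (Z0_gt0 : forall n, 0 < Z0 n)
  (Z0_le : forall n, (0 < n)%N -> Z0 n <= partition_function beta h n)
  (I_ge0 : forall x, 0 <= I x).
Local Notation r n := (radius alpha n).

Hypothesis upper : forall rho e : R, 0 <= rho -> 0 < e ->
  \forall n \near \oo, forall A : pred (n.-tuple bool),
    (forall s, A s -> rho <= I ((magnetization s - m) / r n)) ->
    \sum_(s | A s) gibbs_weight beta h s <= Z0 n * expR (- (a n * (rho - e))).

Hypothesis lower : forall v eta e : R, 0 < eta -> 0 < e ->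
  \forall n \near \oo, Z0 n * expR (- (a n * (I v + e))) <=
    \sum_(s : n.-tuple bool | `|(magnetization s - m) / r n - v| < eta)
      gibbs_weight beta h s.

Let rescaledE n (s : n.-tuple bool) : (0 < n)%N ->
  rescaled_spin m alpha n s = (magnetization s - m) / r n.
Proof.
move=> n0; rewrite /rescaled_spin -mul_radius// /magnetization.
by field; rewrite !gt_eqF// ?radius_gt0// ltr0n.
Qed.

Local Open Scope ereal_scope.
Let mu n C := gibbs beta h n (rescaled_spin m alpha n @^-1` C).
Let u C n := (a n)^-1%:E * lne (mu n C).

Let upper_near C (rho e : R) : (0 <= rho)%R -> (0 < e)%R ->
  (forall x, C x -> (rho <= I x)%R) ->
  \forall n \near \oo, u C n <= (- (rho - e))%:E.
Proof.
move=> rho0 e0 CI; near=> n.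
have n0 : (0 < n)%N by near: n; exists 1%N.
have hn := a_gt0 n0; have Z0n := Z0_gt0 n.
have up : forall A : pred (n.-tuple bool),
    (forall s, A s -> (rho <= I ((magnetization s - m) / r n))%R) ->
    (\sum_(s | A s) gibbs_weight beta h s <= Z0 n * expR (- (a n * (rho - e))))%R.
  by near: n; exact: upper.
rewrite /u /mu gibbsE; set p := (_ / _)%R.
have p_le : (p <= expR (- (a n * (rho - e))))%R.
  rewrite ler_pdivrMr ?partition_function_gt0//.
  apply: (@le_trans _ _ (Z0 n * expR (- (a n * (rho - e))))%R).
    by apply: up => s /set_mem /=; rewrite rescaledE//; exact: CI.
  by rewrite mulrC ler_wpM2l ?expR_ge0// Z0_le.
(* An event of probability zero has [lne] equal to [-oo]. *)
have [p0|p0] := leP p 0%R.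
  by rewrite le0_lneNy ?lee_fin// gt0_muleNy ?leNye// lte_fin invr_gt0.
rewrite lne_EFin// -EFinM lee_fin ler_pdivrMl//.
by rewrite -ler_expR lnK ?posrE// mulrN.
Unshelve. all: by end_near. Qed.

Let lower_near C (v e : R) : C° v -> (0 < e)%R ->
  \forall n \near \oo, (- (I v + e))%:E <= u C n.
Proof.
move=> Cv e0; have [eta /= eta0 etaC] : exists2 eta : R, (0 < eta)%R &
    ball v eta `<=` C.
  by move: Cv => /nbhs_ballP[eta ? ?]; exists eta.
have e20 : (0 < e / 2)%R by rewrite divr_gt0.
near=> n.
have n0 : (0 < n)%N by near: n; exists 1%N.
have hn := a_gt0 n0; have Z0n := Z0_gt0 n.
have Zp := partition_function_gt0 beta h n.
(* Taken at level 0 on the full space, [upper] bounds the partition function itself by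
   [Z0 n * expR (a n * (e / 2))]. *)
have up : forall A : pred (n.-tuple bool),
    (forall s, A s -> (0 <= I ((magnetization s - m) / r n))%R) ->
    (\sum_(s | A s) gibbs_weight beta h s <= Z0 n * expR (- (a n * (0 - e / 2))))%R.
  by near: n; exact: upper.
have lo : (Z0 n * expR (- (a n * (I v + e / 2))) <=
    \sum_(s : n.-tuple bool | `|(magnetization s - m) / r n - v| < eta)
      gibbs_weight beta h s)%R by near: n; exact: lower.
have Z_le : (partition_function beta h n <= Z0 n * expR (a n * (e / 2)))%R.
  have := up xpredT (fun s _ => I_ge0 _).
  by rewrite sub0r mulrN opprK.
rewrite /u /mu gibbsE; set p := (_ / _)%R.
have p_ge : (expR (- (a n * (I v + e))) <= p)%R.
  rewrite ler_pdivlMr//.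
  apply: (@le_trans _ _ (Z0 n * expR (- (a n * (I v + e / 2))))%R).
    apply: le_trans (ler_wpM2l (expR_ge0 _) Z_le) _.
    rewrite mulrCA ler_pM2l// -expRD ler_expR.
    by rewrite le_eqVlt; apply/orP; left; apply/eqP; field.
  apply: (le_trans lo); rewrite [leLHS]big_mkcond [leRHS]big_mkcond/=.
  apply: ler_sum => s _; case: ifPn => [hs|_]; last first.
    by case: ifP => // _; exact: expR_ge0.
  rewrite ifT//; apply/mem_set; rewrite /= rescaledE//; apply: etaC.
  by rewrite /ball /= distrC.
have p0 : (0 < p)%R by rewrite (lt_le_trans (expR_gt0 _) p_ge).
rewrite lne_EFin// -EFinM lee_fin ler_pdivlMl// mulrN.
by rewrite -ler_expR lnK// posrE.
Unshelve. all: by end_near. Qed.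

Lemma mdp_bounds (C : set R) :
  - ereal_inf ((fun x => (I x)%:E) @` C°) <= limn_einf (u C) /\
  limn_esup (u C) <= - ereal_inf ((fun x => (I x)%:E) @` closure C).
Proof.
split.
  rewrite leeNl; apply: le_ereal_inf_tmp => _ [v Cv <-].
  rewrite leeNl; apply/lee_addgt0Pr => e e0.
  rewrite -leeBlDr// (_ : _ - _ = (- (I v + e))%:E); last by rewrite opprD.
  by apply: limn_einf_ge; exact: lower_near.
set l := ereal_inf _.
have l0 : 0 <= l by apply: le_ereal_inf_tmp => _ [x _ <-]; rewrite lee_fin.
have bound (rho e : R) : (0 <= rho)%R -> (0 < e)%R -> rho%:E <= l ->
    limn_esup (u C) <= (- (rho - e))%:E.
  move=> rho0 e0 rhol; apply: limn_esup_le; apply: upper_near => // x Cx.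
  rewrite -lee_fin (le_trans rhol)//; apply: ereal_inf_lbound; exists x => //.
  exact: subset_closure.
case: l l0 bound => [rho| |]//.
  rewrite lee_fin => rho0 bound; apply/lee_addgt0Pr => e e0.
  have := bound rho e rho0 e0 (lexx _).
  by rewrite -EFinN -EFinD opprB addrC.
(* The infimum is [+oo], so the bound holds for every [rho]; a finite value [x] is refuted by
   [rho = |x| + 2]. *)
move=> _ bound; rewrite /= leeNy_eq; apply/eqP.
case: (limn_esup _) bound => // [x|] bound.
  have := bound (`|x| + 2)%R 1%R; rewrite leey lee_fin => /(_ _ ltr01 isT) h'.
  have : (x <= - (`|x| + 2 - 1))%R by apply: h'; rewrite addr_ge0.
  move: (ler_norm (- x)%R); rewrite normrN; move: `|x|%R => y {bound h'}.
  by move=> *; exfalso; lra.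
by have := bound 0%R 1%R (lexx _) ltr01 (leey _).
Qed.

End mdp.

Unset Implicit Arguments.

Theorem theorem3p2 (R : realType) (beta : R) (beta_gt0 : 0 < beta)
    (nu : probability R R)
    (nu_moment2 : (\int[nu]_x (x ^+ 2)%:E < +oo)%E)
    (d : measure_display) (Omega : measurableType d) (P : probability Omega R)
    (h : nat -> {RV P >-> R}) (h_iid : iid_with_law nu h)
    (m : R) (nu_pure : pure_centered beta nu m)
    (k : nat) (lambda : R)
    (m_type : type_strength (G_fun beta nu) m k lambda) :
  {ae P, forall omega, forall alpha : R,
    1 - 1 / (2 * (2 * k%:R - 1)) < alpha < 1 ->
    moderate_deviations_principle
      (fun n => distribution (gibbs beta (fun i => h i omega) n)
                  (rescaled_spin m alpha n))
      (fun n => n%:R `^ (1 - 2 * k%:R * (1 - alpha)))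
      (fun x => (rate beta lambda k x)%:E)}.
Proof.
(* Since the magnetization lies in [[-1, 1]], its distance to [m] never exceeds [L]. *)
pose L := (Num.trunc (`|m| + 1)).+1.
have L_ge : `|m| + 1 <= L%:R.
  have m0 : 0 <= `|m| + 1 by rewrite addr_ge0.
  by have /andP[_ /ltW] := truncn_itv m0.
have := empirical_G_concentration beta_gt0 nu_moment2 m h_iid L.
(* The concentration event does not involve [alpha], so one null set serves all [alpha]. *)
apply: filterS => w conc alpha alpha_range.
split; first exact: (good_rate_function_rate beta_gt0 nu_moment2 m_type).
move=> C mC.
apply: (@mdp_bounds R beta (fun i => h i w) m alpha (speed k alpha)
  (rate beta lambda k)
  (fun n => 2 ^+ n * expR (- (n%:R * empirical_G beta (fun i => h i w) n m)))).
- by move=> n; exact: speed_gt0.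
- by move=> n; rewrite mulr_gt0 ?exprn_gt0 ?expR_gt0.
- by move=> n n0; exact: partition_function_ge.
- exact: (rate_ge0 beta_gt0 nu_moment2 m_type).
- move=> rho e; exact: (near_sum_weight_le beta_gt0 nu_moment2 nu_pure m_type
    alpha_range L_ge conc).
- move=> v eta e; exact: (near_window_weight_ge beta_gt0 nu_moment2 m_type
    alpha_range L_ge conc).
Qed.
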